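(* Let $h_\Gamma\in C^2(\mathbb{R})$ be real-valued with compact support, $\Gamma=\{(x_1,x_2): x_2=h_\Gamma(x_1),\ x_1\in\mathbb{R}\}$, and let $D_+$ be the unbounded domain above $\Gamma$. Let $\ell\in\mathbb{R}$, let $\Gamma^\ell=\{(x_1+\ell,h_\Gamma(x_1)):x_1\in\mathbb{R}\}$ be the surface shifted along the $x_1$ direction. Let the wave number $k>0$ be given and let the incident wave be the plane wave $u^i(x;d,k)=\exp(ikd\cdot x)$ with incident direction $d=(\sin\theta,-\cos\theta)$ and incident angle $\theta\in(-\pi/2,\pi/2)$. Let $u^s(x;d,k)$ and $u^s_\ell(x;d,k)$ be the scattering solutions corresponding to the surface $\Gamma$ and to the shifted surface $\Gamma^\ell$, respectively, let $u^\infty(\hat{x};d,k)$ and $u^\infty_\ell(\hat{x};d,k)$ be their far-field patterns, and let $u^{near}(x;d,k)$ and $u^{near}_\ell(x;d,k)$ be the corresponding near-fields. For $x\in\mathbb{R}^2$ write $x^{\ell}:=x+(\ell,0)^T$. Then $$u^s_\ell(x^{\ell};d,k)=e^{ik\ell\sin\theta}u^s(x;d,k),\qquad u^{near}_\ell(x^{\ell};d,k)=e^{ik\ell\sin\theta}u^{near}(x;d,k),\qquad x\in D_+,$$ and $$u^\infty_\ell(\hat{x};d,k)=e^{ik\ell(\sin\theta-\hat{x}_1)}u^\infty(\hat{x};d,k),\qquad \hat{x}\in\mathbb{S}^1_+,$$ where $\hat{x}_1$ is the first component of $\hat{x}$.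
   Context: Notation: $\mathbb{S}^1_+:=\{x=(x_1,x_2)\in\mathbb{R}^2:|x|=1,\ x_2>0\}$. Scattering problem for a locally rough surface. A locally rough surface is a graph $\Gamma=\{(x_1,x_2):x_2=h_\Gamma(x_1),\ x_1\in\mathbb{R}\}$ with $h_\Gamma\in C^2(\mathbb{R})$ of compact support; $D_+$ is the unbounded domain above $\Gamma$. For the incident plane wave $u^i(x;d,k)=\exp(ikd\cdot x)$, $d=(\sin\theta,-\cos\theta)$, the reflected wave with respect to the infinite plane $x_2=0$ is $u^r(x;d,k)=-\exp(ikd'\cdot x)$ with $d'=(\sin\theta,\cos\theta)$. The scattering solution (scattered field) $u^s=u^s(\cdot;d,k)$ corresponding to $\Gamma$ is the unique (classical: $C^2$ in $D_+$, continuous up to $\Gamma$) solution of $$\Delta u^s+k^2u^s=0\ \text{ in } D_+,\qquad u^s=-(u^i+u^r)\ \text{ on }\Gamma,\qquad \lim_{r\to\infty}r^{1/2}\Big(\frac{\partial u^s}{\partial r}-ik u^s\Big)=0,\ r=|x|,$$ the last being the Sommerfeld radiation condition. Existence and uniqueness of this solution are known. For $\Gamma^\ell$ the scattering solution is defined in the same way, with $\Gamma$ replaced by $\Gamma^\ell$ and $D_+$ replaced by the unbounded domain $D_+^\ell$ above $\Gamma^\ell$, and with the same $u^i$ and $u^r$. Far-field pattern: $u^s$ has the asymptotic behavior $$u^s(x;d,k)=\frac{e^{ik|x|}}{\sqrt{|x|}}\Big(u^\infty(\hat{x};d,k)+O\Big(\frac1{|x|}\Big)\Big),\quad |x|\to\infty,$$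 uniformly for all $\hat{x}=x/|x|\in\mathbb{S}^1_+$; $u^\infty$ is called the far-field pattern of $u^s$. The near-field is $u^{near}:=u^r+u^s$ (and $u^{near}_\ell:=u^r+u^s_\ell$). *)

(* Defs.v *)
From Stdlib Require Import Reals.
From Coquelicot Require Import Coquelicot.
Open Scope R_scope.

(* Points of the plane are pairs of reals; wave fields are total functions
   R * R -> C, only their values on the relevant region being constrained. *)

Definition vdot (x y : R * R) : R := fst x * fst y + snd x * snd y.
Definition enorm (x : R * R) : R := sqrt (fst x ^ 2 + snd x ^ 2).
Definition vscale (r : R) (x : R * R) : R * R := (r * fst x, r * snd x).
Definition unit_vec (x : R * R) : R * R := vscale (/ enorm x) x.

Definition upper_circle (x : R * R) : Prop := enorm x = 1 /\ 0 < snd x.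

Definition expi (t : R) : C := (cos t, sin t).

(* Componentwise derivative of a complex-valued function of a real variable.
   Like [Derive] it is total; it is only used where the function is assumed
   to be differentiable. *)
Definition DeriveC (f : R -> C) (t : R) : C :=
  (Derive (fun s => Re (f s)) t, Derive (fun s => Im (f s)) t).

Definition dx1 (u : R * R -> C) (x : R * R) : C :=
  DeriveC (fun s => u (s, snd x)) (fst x).
Definition dx2 (u : R * R -> C) (x : R * R) : C :=
  DeriveC (fun s => u (fst x, s)) (snd x).

Definition laplacian (u : R * R -> C) (x : R * R) : C :=
  (dx1 (dx1 u) x + dx2 (dx2 u) x)%C.

Definition radial_derivative (u : R * R -> C) (x : R * R) : C :=
  DeriveC (fun r => u (vscale r (unit_vec x))) (enorm x).

(* For an open set [D], [ex_diff_n _ 2] at every point of [D] says that all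
   partial derivatives of order at most 2 exist and are continuous on [D]. *)
Definition C2_on (D : R * R -> Prop) (u : R * R -> C) : Prop :=
  forall x, D x ->
    ex_diff_n (fun s t => Re (u (s, t))) 2 (fst x) (snd x) /\
    ex_diff_n (fun s t => Im (u (s, t))) 2 (fst x) (snd x).

(* [ex_derive_n h 2] alone does not imply differentiability of [h], because
   [Derive] is total; hence the separate first-order clause. *)
Definition C2_line (h : R -> R) : Prop :=
  forall t, ex_derive_n h 1 t /\ ex_derive_n h 2 t /\
            continuous (Derive_n h 2) t.

Definition compact_support (h : R -> R) : Prop :=
  compact (adherence (fun t => h t <> 0)).

Definition surface (h : R -> R) (x : R * R) : Prop := snd x = h (fst x).

Definition translate1 (l : R) (x : R * R) : R * R := (fst x + l, snd x).

Definition shifted_surface (l : R) (h : R -> R) (x : R * R) : Prop :=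
  exists t : R, x = (t + l, h t).

Definition domain_above (S : R * R -> Prop) (x : R * R) : Prop :=
  exists t : R, S (fst x, t) /\ t < snd x.

Definition closed_domain_above (S : R * R -> Prop) (x : R * R) : Prop :=
  domain_above S x \/ S x.

Definition incident_wave (k theta : R) (x : R * R) : C :=
  expi (k * vdot (sin theta, - cos theta) x).

Definition reflected_wave (k theta : R) (x : R * R) : C :=
  (- expi (k * vdot (sin theta, cos theta) x))%C.

(* The limit is uniform over the directions of [x]. *)
Definition radiation_condition (k : R) (D : R * R -> Prop) (u : R * R -> C)
  : Prop :=
  forall eps : R, 0 < eps ->
  exists R0 : R, forall x, D x -> R0 < enorm x ->
    Cmod (sqrt (enorm x) * (radial_derivative u x - Ci * k * u x))%C < eps.

Definition solves_scattering_problem (S : R * R -> Prop) (k theta : R)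
    (u : R * R -> C) : Prop :=
  C2_on (domain_above S) u /\
  continuous_on (closed_domain_above S) u /\
  (forall x, domain_above S x -> (laplacian u x + k ^ 2 * u x)%C = 0) /\
  (forall x, S x ->
     u x = (- (incident_wave k theta x + reflected_wave k theta x))%C) /\
  radiation_condition k (domain_above S) u.

(* "The" scattering solution: the unique solution of the scattering problem.
   Uniqueness is meant as functions on the domain and its boundary. *)
Definition is_scattering_solution (S : R * R -> Prop) (k theta : R)
    (u : R * R -> C) : Prop :=
  solves_scattering_problem S k theta u /\
  forall v, solves_scattering_problem S k theta v ->
    forall x, closed_domain_above S x -> v x = u x.

Definition near_field (k theta : R) (us : R * R -> C) (x : R * R) : C :=
  (reflected_wave k theta x + us x)%C.

(* [w] is the O(1/|x|) remainder, uniform over the directions in the open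
   upper half circle; points far out in such directions lie above the
   surface, whose height function is compactly supported. *)
Definition is_far_field (k : R) (us uinf : R * R -> C) : Prop :=
  exists (w : R * R -> C) (C0 R0 : R), 0 < R0 /\
    forall x, R0 < enorm x -> upper_circle (unit_vec x) ->
      us x = (expi (k * enorm x) / sqrt (enorm x)
                * (uinf (unit_vec x) + w x))%C /\
      Cmod (w x) <= C0 / enorm x.

(* Main.v *)
(* The field [e^(ikl sin theta) u^s(x - (l,0))] solves the scattering problem for
   the shifted surface, so it is [u^s_l] by uniqueness.  Only the radiation
   condition is not immediate: the radial directions at [x] and at [x + (l,0)]
   differ by [O(1/|x|)], so one needs a bound on the gradient of [u^s] at
   infinity, up to the boundary.  Far away the surface is the flat line
   [x2 = 0], on which [u^s] vanishes, and [u^s] is bounded by its far-field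
   expansion; comparison with quadratic barriers (maximum principle) then
   bounds the gradient.  The far-field identity follows by letting
   [x = r xhat] tend to infinity in [u^s_l(x) = e^(ikl sin theta) u^s(x - (l,0))],
   using [|x - (l,0)| - |x| -> - l xhat1] and the continuity of the far-field
   pattern. *)
Require Import Defs.
From Stdlib Require Import Reals Lra Classical ClassicalEpsilon.
From Coquelicot Require Import Coquelicot.
Open Scope R_scope.

(** * Maximum principle and gradient estimates *)

(** The radiation condition controls only the radial part of the gradient, while the shift turns the
    radial direction and so admits the tangential part with weight [|l| / |x|]. Against the factor
    [sqrt |x|] this costs [O(|x|^(-1/2))] once the gradient is merely bounded, so no decay of the
    tangential derivative has to be known.

    For that bound, the zeroth-order term of the Helmholtz equation has the sign for which the
    maximum principle fails. It is moved to the right-hand side: real and imaginary parts each solve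
    [Delta u = f] with [|f| <= k^2 M], and a barrier with Laplacian [- N] absorbs [f].

    That the far-field expansion bounds [us] is not immediate either. A priori [uinf] might blow up
    towards the ends of the open half circle, and horizontal directions are not covered. The
    expansion is therefore read backwards on one large semicircle, which is compact up to the flat
    boundary, where [us] is continuous. *)

Definition closed_box (a b c d : R) (p : R * R) : Prop :=
  a <= fst p <= b /\ c <= snd p <= d.

Definition open_box (a b c d : R) (x y : R) : Prop :=
  a < x < b /\ c < y < d.

(** Compactness of the rectangle: local margins can be replaced by one margin because shrinking [e]
    preserves [F e]. The covering theorem [compactness_value_2d] concludes under a double negation,
    hence the appeal to [NNPP]. *)
Lemma closed_box_uniform (a b c d : R) (F : R -> R * R -> Prop) :
  (forall e e' q, 0 < e' <= e -> F e q -> F e' q) ->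
  (forall p, closed_box a b c d p ->
     exists e, 0 < e /\ forall q, closed_box a b c d q ->
       Rabs (fst q - fst p) < e -> Rabs (snd q - snd p) < e -> F e q) ->
  exists e, 0 < e /\ forall q, closed_box a b c d q -> F e q.
Proof.
  intros Hanti Hloc.
  assert (Hd : forall x y, exists e : posreal, closed_box a b c d (x, y) ->
     forall q, closed_box a b c d q ->
       Rabs (fst q - x) < e -> Rabs (snd q - y) < e -> F e q).
  { intros x y. destruct (classic (closed_box a b c d (x, y))) as [Hb|Hb].
    - destruct (Hloc _ Hb) as [e [He H]]. exists (mkposreal e He). auto.
    - exists (mkposreal 1 Rlt_0_1). tauto. }
  pose (delta := fun x y => proj1_sig (constructive_indefinite_description _ (Hd x y))).
  destruct (compactness_value_2d a b c d delta) as [e He].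
  exists e. split; [apply cond_pos|].
  intros [x y] [Hx Hy]. apply NNPP. intros HF.
  apply (He x y Hx Hy). intros [u [v [Hu [Hv [H1 [H2 H3]]]]]].
  apply HF, (Hanti (delta u v)). { split; [apply cond_pos|exact H3]. }
  unfold delta in *. destruct (constructive_indefinite_description _ (Hd u v)) as [e' He'].
  simpl in *. apply He'; repeat split; simpl in *; tauto.
Qed.

Lemma continuous_on_box_eps (a b c d : R) (f : R * R -> R) (p : R * R) (eps : R) :
  continuous_on (closed_box a b c d) f -> closed_box a b c d p -> 0 < eps ->
  exists e, 0 < e /\ forall q, closed_box a b c d q ->
    Rabs (fst q - fst p) < e -> Rabs (snd q - snd p) < e -> Rabs (f q - f p) < eps.
Proof.
  intros Hf Hp Heps.
  destruct (Hf p Hp (ball (f p) (mkposreal eps Heps)) (locally_ball _ _)) as [e He].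
  exists e. split; [apply cond_pos|]. intros q Hq H1 H2.
  apply He; [split|]; assumption.
Qed.

Lemma continuous_on_box_bounded (a b c d : R) (f : R * R -> R) :
  continuous_on (closed_box a b c d) f ->
  exists K, forall q, closed_box a b c d q -> f q <= K.
Proof.
  intros Hf.
  (* Writing the bound as [/ e] makes the property weaker as [e] decreases, as the compactness lemma
     demands. *)
  destruct (closed_box_uniform a b c d (fun e q => f q <= / e)) as [e [He H]].
  - intros e e' q [H0 H1] H2. apply Rle_trans with (1 := H2), Rinv_le_contravar; lra.
  - intros p Hp.
    destruct (continuous_on_box_eps a b c d f p 1 Hf Hp Rlt_0_1) as [e [He H]].
    pose proof (Rabs_pos (f p)) as Hfp.
    exists (Rmin e (/ (Rabs (f p) + 1))).
    assert (Hpos : 0 < Rmin e (/ (Rabs (f p) + 1))).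
    { apply Rmin_glb_lt; [lra|apply Rinv_0_lt_compat; lra]. }
    split; [exact Hpos|]. intros q Hq H1 H2.
    pose proof (Rmin_l e (/ (Rabs (f p) + 1))).
    pose proof (Rmin_r e (/ (Rabs (f p) + 1))).
    specialize (H q Hq ltac:(lra) ltac:(lra)). apply Rabs_def2 in H.
    apply Rle_trans with (Rabs (f p) + 1); [pose proof (Rle_abs (f p)); lra|].
    apply Rle_trans with (/ / (Rabs (f p) + 1)); [rewrite Rinv_inv; lra|].
    apply Rinv_le_contravar; lra.
  - exists (/ e). exact H.
Qed.

Lemma continuous_on_box_max (a b c d : R) (f : R * R -> R) :
  a <= b -> c <= d -> continuous_on (closed_box a b c d) f ->
  exists p, closed_box a b c d p /\ forall q, closed_box a b c d q -> f q <= f p.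
Proof.
  intros Hab Hcd Hf.
  destruct (continuous_on_box_bounded a b c d f Hf) as [K HK].
  destruct (completeness (fun z => exists q, closed_box a b c d q /\ z = f q)) as [m [Hm1 Hm2]].
  - exists K. intros z [q [Hq ->]]. auto.
  - exists (f (a, c)), (a, c). repeat split; simpl; lra.
  - apply NNPP. intros Hno.
    assert (Hlt : forall p, closed_box a b c d p -> f p < m).
    { intros p Hp. destruct (Hm1 (f p)) as [H|H]; [exists p; auto|exact H|].
      exfalso. apply Hno. exists p. split; [exact Hp|]. intros q Hq. rewrite H.
      apply Hm1. exists q; auto. }
    (* If the supremum [m] were not attained, the gap [m - f] would be at least some fixed [e > 0],
       and [m - e] would be a smaller upper bound. *)
    destruct (closed_box_uniform a b c d (fun e q => f q <= m - e)) as [e [He H]].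
    + intros; lra.
    + intros p Hp. specialize (Hlt p Hp).
      destruct (continuous_on_box_eps a b c d f p ((m - f p) / 2) Hf Hp) as [e [He H]]; [lra|].
      exists (Rmin e ((m - f p) / 2)). split; [apply Rmin_glb_lt; lra|].
      pose proof (Rmin_l e ((m - f p) / 2)). pose proof (Rmin_r e ((m - f p) / 2)).
      intros q Hq Hq1 Hq2. specialize (H q Hq ltac:(lra) ltac:(lra)).
      apply Rabs_def2 in H. lra.
    + assert (m <= m - e); [|lra]. apply Hm2. intros z [q [Hq ->]]. auto.
Qed.

(** Fermat gives [f' x = 0]. If [l] were positive, [f'] would be positive just to the right of [x],
    and the mean value theorem would lift [f] above its maximum. *)
Lemma local_max_second_derivative (f f' : R -> R) (x l r : R) :
  0 < r ->
  (forall z, x - r < z < x + r -> is_derive f z (f' z)) ->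
  is_derive f' x l ->
  (forall z, x - r < z < x + r -> f z <= f x) -> l <= 0.
Proof.
  intros Hr Hf Hf' Hmax.
  assert (Hx0 : f' x = 0).
  { assert (Hd : derivable_pt_lim f x (f' x)).
    { apply is_derive_Reals, Hf. lra. }
    rewrite <- (derive_pt_eq_0 f x (f' x) (exist _ _ Hd) Hd).
    apply (deriv_maximum f (x - r) (x + r)); try lra. intros; apply Hmax; lra. }
  destruct (Rle_or_lt l 0) as [H|Hl]; [exact H|exfalso].
  apply is_derive_Reals in Hf'.
  destruct (Hf' l Hl) as [[e He] H]. simpl in H.
  set (t := Rmin e r / 2).
  assert (Ht : 0 < t < e /\ t < r).
  { unfold t. pose proof (Rmin_glb_lt e r 0 He Hr).
    pose proof (Rmin_l e r). pose proof (Rmin_r e r). lra. }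
  destruct (MVT_cor2 f f' x (x + t)) as [c [Hc1 Hc2]]; [lra| |].
  - intros c Hc. apply is_derive_Reals, Hf. lra.
  - specialize (H (c - x) ltac:(lra)). rewrite (Rabs_right (c - x)) in H by lra.
    specialize (H ltac:(lra)). replace (x + (c - x)) with c in H by ring.
    rewrite Hx0 in H. apply Rabs_def2 in H.
    assert (Hq : 0 < (f' c - 0) / (c - x)) by lra.
    assert (Hc : 0 < f' c).
    { replace (f' c) with ((f' c - 0) / (c - x) * (c - x)) by (field; lra).
      apply Rmult_lt_0_compat; lra. }
    pose proof (Hmax (x + t) ltac:(lra)).
    pose proof (Rmult_lt_0_compat _ _ Hc (proj1 (proj1 Ht))).
    replace (x + t - x) with t in Hc1 by ring. lra.
Qed.

(** The derivatives are arguments instead of [Derive] terms, so that differences, reflections and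
    coordinate swaps carry explicit derivatives along. *)
Definition second_partials (D : R -> R -> Prop) (u ux uy uxx uyy : R -> R -> R) : Prop :=
  forall x y, D x y ->
    is_derive (fun z => u z y) x (ux x y) /\ is_derive (fun z => u x z) y (uy x y) /\
    is_derive (fun z => ux z y) x (uxx x y) /\ is_derive (fun z => uy x z) y (uyy x y).

Definition uncurry2 (u : R -> R -> R) (p : R * R) : R := u (fst p) (snd p).

(** At an interior maximum both pure second derivatives are at most 0, against the positive
    Laplacian, so the maximum sits on the boundary. Strict positivity saves the usual perturbation
    argument; it is why the later bounds on the Laplacian are strict. *)
Lemma weak_maximum_principle (a b c d : R) (g gx gy gxx gyy : R -> R -> R) :
  a <= b -> c <= d ->
  continuous_on (closed_box a b c d) (uncurry2 g) ->
  second_partials (open_box a b c d) g gx gy gxx gyy ->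
  (forall x y, open_box a b c d x y -> 0 < gxx x y + gyy x y) ->
  (forall x y, closed_box a b c d (x, y) -> ~ open_box a b c d x y -> g x y <= 0) ->
  forall x y, closed_box a b c d (x, y) -> g x y <= 0.
Proof.
  intros Hab Hcd Hc Hd Hlap Hbd x y Hxy.
  destruct (continuous_on_box_max a b c d _ Hab Hcd Hc) as [[x0 y0] [Hp Hmax]].
  apply Rle_trans with (1 := Hmax _ Hxy). unfold uncurry2 in *; simpl in *.
  destruct (classic (open_box a b c d x0 y0)) as [Ho|Ho]; [exfalso|auto].
  specialize (Hlap _ _ Ho). destruct Ho as [Hx Hy].
  assert (gxx x0 y0 <= 0).
  { apply (local_max_second_derivative (fun z => g z y0) (fun z => gx z y0) x0 _ (Rmin (x0 - a) (b - x0))).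
    - apply Rmin_glb_lt; lra.
    - intros z Hz. pose proof (Rmin_l (x0 - a) (b - x0)). pose proof (Rmin_r (x0 - a) (b - x0)).
      apply Hd. split; lra.
    - apply Hd. split; lra.
    - intros z Hz. pose proof (Rmin_l (x0 - a) (b - x0)). pose proof (Rmin_r (x0 - a) (b - x0)).
      apply (Hmax (z, y0)). split; simpl; lra. }
  assert (gyy x0 y0 <= 0).
  { apply (local_max_second_derivative (fun z => g x0 z) (fun z => gy x0 z) y0 _ (Rmin (y0 - c) (d - y0))).
    - apply Rmin_glb_lt; lra.
    - intros z Hz. pose proof (Rmin_l (y0 - c) (d - y0)). pose proof (Rmin_r (y0 - c) (d - y0)).
      apply Hd. split; lra.
    - apply Hd. split; lra.
    - intros z Hz. pose proof (Rmin_l (y0 - c) (d - y0)). pose proof (Rmin_r (y0 - c) (d - y0)).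
      apply (Hmax (x0, z)). split; simpl; lra. }
  lra.
Qed.

Lemma continuous_pair {T U V : UniformSpace} (f : T -> U) (g : T -> V) (x : T) :
  continuous f x -> continuous g x -> continuous (fun y => (f y, g y)) x.
Proof.
  intros Hf Hg. apply (continuous_comp_2 f g pair); [exact Hf|exact Hg|].
  apply continuous_ext with (f := fun p => p); [intros [p q]; reflexivity|].
  apply continuous_id.
Qed.

Lemma continuous_on_comp {T U V : UniformSpace} (D : U -> Prop) (E : T -> Prop)
    (f : U -> V) (g : T -> U) :
  (forall x, E x -> continuous g x) -> (forall x, E x -> D (g x)) ->
  continuous_on D f -> continuous_on E (fun x => f (g x)).
Proof.
  intros Hg HED Hf x Hx.
  apply filterlim_comp with (2 := Hf (g x) (HED x Hx)).
  intros P HP. unfold within in HP. specialize (Hg x Hx _ HP).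
  unfold filtermap, within in *. apply filter_imp with (2 := Hg). auto.
Qed.

Lemma continuous_on_minus {T : UniformSpace} (E : T -> Prop) (f g : T -> R) :
  continuous_on E f -> continuous_on E g -> continuous_on E (fun x => f x - g x).
Proof.
  intros Hf Hg x Hx.
  apply (filterlim_comp_2 (G := locally (f x)) (H := locally (opp (g x)))
    f (fun y => opp (g y)) plus).
  - apply Hf, Hx.
  - apply (filterlim_comp _ _ _ g opp _ (locally (g x))); [apply Hg, Hx|].
    apply (filterlim_opp (V := R_NormedModule)).
  - apply (filterlim_plus (V := R_NormedModule)).
Qed.

(** The barrier [psi] has Laplacian [2 * m - 2 * B = - N], is nonnegative on the bottom side and at
    least [M] on the other three. Hence [g - psi] has positive Laplacian and is at most 0 on the
    boundary. On the midline [psi a s <= A * s], and [A] is the constant in the conclusion. *)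
Lemma barrier_upper_bound (a d M N : R) (g gx gy gxx gyy : R -> R -> R) :
  0 < d -> 0 <= N ->
  continuous_on (closed_box (a - d) (a + d) 0 d) (uncurry2 g) ->
  second_partials (open_box (a - d) (a + d) 0 d) g gx gy gxx gyy ->
  (forall x y, open_box (a - d) (a + d) 0 d x y -> - N < gxx x y + gyy x y) ->
  (forall x y, closed_box (a - d) (a + d) 0 d (x, y) -> g x y <= M) -> 0 <= M ->
  (forall x, a - d <= x <= a + d -> g x 0 <= 0) ->
  forall s, 0 <= s <= d -> g a s <= s * (2 * M / d + N * d / 2).
Proof.
  intros Hd HN Hc Hsp Hlap HM HM0 Hbot s Hs.
  set (m := M / d ^ 2).
  assert (Hm : M = m * d ^ 2) by (unfold m; field; lra).
  assert (Hm0 : 0 <= m).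
  { unfold m. apply Rmult_le_pos; [lra|]. apply Rlt_le, Rinv_0_lt_compat, pow_lt, Hd. }
  replace (2 * M / d + N * d / 2) with (2 * m * d + N * d / 2) by (rewrite Hm; field; lra).
  (* [B] is dictated by the Laplacian of [psi], and [A] by the top side: it makes [d * (A - B * d)]
     equal to [m * d ^ 2 = M]. *)
  set (B := m + N / 2). set (A := B * d + m * d).
  assert (HAB : forall y, 0 <= y <= d -> 0 <= y * (A - B * y)).
  { intros y Hy. apply Rmult_le_pos; [lra|]. unfold A.
    assert (0 <= B * (d - y)) by (apply Rmult_le_pos; unfold B; lra).
    pose proof (Rmult_le_pos _ _ Hm0 (Rlt_le _ _ Hd)). lra. }
  pose (psi := fun x y => m * (x - a) ^ 2 + y * (A - B * y)).
  assert (H : g a s - psi a s <= 0).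
  { apply (weak_maximum_principle (a - d) (a + d) 0 d (fun x y => g x y - psi x y)
      (fun x y => gx x y - 2 * m * (x - a)) (fun x y => gy x y - (A - 2 * B * y))
      (fun x y => gxx x y - 2 * m) (fun x y => gyy x y + 2 * B)); try lra.
    - apply (continuous_on_minus _ (uncurry2 g) (uncurry2 psi)); [exact Hc|].
      apply continuous_on_forall. intros [x y] _. unfold uncurry2, psi.
      apply (continuity_2d_pt_filterlim psi). unfold psi.
      apply continuity_2d_pt_plus.
      + apply continuity_2d_pt_mult; [apply continuity_2d_pt_const|].
        apply continuity_2d_pt_ext with (f := fun x _ => (x - a) * (x - a)); [intros; ring|].
        apply continuity_2d_pt_mult; apply continuity_2d_pt_minus;
          auto using continuity_2d_pt_const, continuity_2d_pt_id1.
      + apply continuity_2d_pt_mult; [apply continuity_2d_pt_id2|].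
        apply continuity_2d_pt_minus; [apply continuity_2d_pt_const|].
        apply continuity_2d_pt_mult; auto using continuity_2d_pt_const, continuity_2d_pt_id2.
    - intros x y Hxy. destruct (Hsp x y Hxy) as [H1 [H2 [H3 H4]]]. unfold psi.
      split; [|split; [|split]].
      + apply (is_derive_minus (fun z => g z y)); [exact H1|]. auto_derive; [auto|ring].
      + apply (is_derive_minus (fun z => g x z)); [exact H2|]. auto_derive; [auto|ring].
      + apply (is_derive_minus (fun z => gx z y)); [exact H3|]. auto_derive; [auto|ring].
      + replace (gyy x y + 2 * B) with (gyy x y - (- (2 * B))) by ring.
        apply (is_derive_minus (fun z => gy x z)); [exact H4|]. auto_derive; [auto|ring].
    - intros x y Hxy. specialize (Hlap x y Hxy). unfold B. lra.
    - intros x y Hxy Hno. specialize (HM x y Hxy). destruct Hxy as [Hx Hy]; cbn [fst snd] in *.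
      specialize (HAB y Hy).
      assert (Hsq : 0 <= m * (x - a) ^ 2) by (apply Rmult_le_pos; [lra|apply pow2_ge_0]).
      destruct (Req_dec y 0) as [->|Hy0].
      { specialize (Hbot x Hx). unfold psi. lra. }
      destruct (Req_dec y d) as [->|Hyd].
      { unfold psi. replace (d * (A - B * d)) with M by (rewrite Hm; unfold A; ring). lra. }
      assert (He : (x - a) ^ 2 = d ^ 2).
      { destruct (Req_dec x (a - d)) as [->|]; [ring|].
        destruct (Req_dec x (a + d)) as [->|]; [ring|].
        exfalso. apply Hno. split; lra. }
      unfold psi. rewrite He, <- Hm. lra.
    - split; simpl; lra. }
  unfold psi in H. replace (a - a) with 0 in H by ring.
  assert (0 <= B * (s * s)) by (apply Rmult_le_pos; [unfold B; lra|nra]).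
  assert (HA : A = 2 * m * d + N * d / 2) by (unfold A, B; field).
  rewrite <- HA. nra.
Qed.

Lemma second_partials_opp (D : R -> R -> Prop) (u ux uy uxx uyy : R -> R -> R) :
  second_partials D u ux uy uxx uyy ->
  second_partials D (fun x y => - u x y) (fun x y => - ux x y) (fun x y => - uy x y)
    (fun x y => - uxx x y) (fun x y => - uyy x y).
Proof.
  intros H x y Hxy. destruct (H x y Hxy) as [H1 [H2 [H3 H4]]].
  refine (conj _ (conj _ (conj _ _))).
  - apply (is_derive_opp (fun z => u z y)), H1.
  - apply (is_derive_opp (fun z => u x z)), H2.
  - apply (is_derive_opp (fun z => ux z y)), H3.
  - apply (is_derive_opp (fun z => uy x z)), H4.
Qed.

Lemma continuous_on_opp {T : UniformSpace} (E : T -> Prop) (f : T -> R) :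
  continuous_on E f -> continuous_on E (fun x => - f x).
Proof.
  intros Hf. apply continuous_on_ext with (f := fun x => 0 - f x); [intros x _; apply Rminus_0_l|].
  apply continuous_on_minus; [|exact Hf].
  apply continuous_on_forall. intros; apply continuous_const.
Qed.

Lemma barrier_bound (a d M N : R) (g gx gy gxx gyy : R -> R -> R) :
  0 < d -> 0 <= M -> 0 <= N ->
  continuous_on (closed_box (a - d) (a + d) 0 d) (uncurry2 g) ->
  second_partials (open_box (a - d) (a + d) 0 d) g gx gy gxx gyy ->
  (forall x y, open_box (a - d) (a + d) 0 d x y -> Rabs (gxx x y + gyy x y) < N) ->
  (forall x y, closed_box (a - d) (a + d) 0 d (x, y) -> Rabs (g x y) <= M) ->
  (forall x, a - d <= x <= a + d -> g x 0 = 0) ->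
  forall s, 0 <= s <= d -> Rabs (g a s) <= s * (2 * M / d + N * d / 2).
Proof.
  intros Hd HM0 HN Hc Hsp Hlap HM Hbot s Hs. apply Rabs_le. split.
  - assert (- g a s <= s * (2 * M / d + N * d / 2)); [|lra].
    apply (barrier_upper_bound a d M N (fun x y => - g x y) (fun x y => - gx x y)
      (fun x y => - gy x y) (fun x y => - gxx x y) (fun x y => - gyy x y)); auto.
    + apply continuous_on_opp with (1 := Hc).
    + apply second_partials_opp, Hsp.
    + intros x y Hxy. specialize (Hlap x y Hxy). apply Rabs_def2 in Hlap. lra.
    + intros x y Hxy. specialize (HM x y Hxy). apply Rabs_le_between in HM. lra.
    + intros x Hx. rewrite Hbot; lra.
  - apply (barrier_upper_bound a d M N g gx gy gxx gyy); auto.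
    + intros x y Hxy. specialize (Hlap x y Hxy). apply Rabs_def2 in Hlap. lra.
    + intros x y Hxy. specialize (HM x y Hxy). apply Rabs_le_between in HM. lra.
    + intros x Hx. rewrite Hbot; lra.
Qed.

Lemma is_derive_shift (f : R -> R) (t y l : R) :
  is_derive f (t + y) l -> is_derive (fun z => f (t + z)) y l.
Proof.
  intros H. replace l with (scal 1 l) by apply Rmult_1_l.
  apply (is_derive_comp f (fun z => t + z)); [exact H|]. auto_derive; auto.
Qed.

Lemma is_derive_reflect (f : R -> R) (t y l : R) :
  is_derive f (t - y) l -> is_derive (fun z => f (t - z)) y (- l).
Proof.
  intros H. replace (- l) with (scal (-1) l) by (unfold scal; simpl; unfold mult; simpl; ring).
  apply (is_derive_comp f (fun z => t - z)); [exact H|]. auto_derive; auto; ring.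
Qed.

(* The odd part of [u] in the second variable about [t] vanishes at [t], so the
   barrier bounds its slope there. *)
Lemma interior_dy_bound (a t d M N : R) (u ux uy uxx uyy : R -> R -> R) :
  0 < d -> 0 <= M -> 0 <= N ->
  continuous_on (closed_box (a - d) (a + d) (t - d) (t + d)) (uncurry2 u) ->
  second_partials (open_box (a - d) (a + d) (t - d) (t + d)) u ux uy uxx uyy ->
  (forall x y, open_box (a - d) (a + d) (t - d) (t + d) x y ->
     Rabs (uxx x y + uyy x y) < N) ->
  (forall x y, closed_box (a - d) (a + d) (t - d) (t + d) (x, y) ->
     Rabs (u x y) <= M) ->
  Rabs (uy a t) <= 2 * M / d + N * d / 2.
Proof.
  intros Hd HM0 HN Hc Hsp Hlap HM.
  set (K := 2 * M / d + N * d / 2).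
  pose (g := fun x s => u x (t + s) - u x (t - s)).
  assert (Hg : forall s, 0 <= s <= d -> Rabs (g a s) <= s * (2 * K)).
  (* Forming the difference doubles both [M] and [N]. The slope of [g a] at 0 is [2 * uy a t], so
     the factor 2 cancels in the end. *)
  { replace (2 * K) with (2 * (2 * M) / d + (2 * N) * d / 2) by (unfold K; field; lra).
    apply (barrier_bound a d (2 * M) (2 * N) g
      (fun x s => ux x (t + s) - ux x (t - s))
      (fun x s => uy x (t + s) + uy x (t - s))
      (fun x s => uxx x (t + s) - uxx x (t - s))
      (fun x s => uyy x (t + s) - uyy x (t - s))); try lra.
    - unfold uncurry2, g. apply continuous_on_minus.
      + apply (continuous_on_comp (U := prod_UniformSpace R_UniformSpace R_UniformSpace)
          _ _ (uncurry2 u) (fun p : R * R => (fst p, t + snd p))) with (3 := Hc).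
        * intros p _. apply continuous_pair; [apply continuous_fst|].
          apply (continuous_plus (V := R_NormedModule)); [apply continuous_const|apply continuous_snd].
        * intros p [Hp1 Hp2]. split; simpl; lra.
      + apply (continuous_on_comp (U := prod_UniformSpace R_UniformSpace R_UniformSpace)
          _ _ (uncurry2 u) (fun p : R * R => (fst p, t - snd p))) with (3 := Hc).
        * intros p _. apply continuous_pair; [apply continuous_fst|].
          apply (continuous_minus (V := R_NormedModule)); [apply continuous_const|apply continuous_snd].
        * intros p [Hp1 Hp2]. split; simpl; lra.
    - intros x y [Hx Hy].
      destruct (Hsp x (t + y)) as [H1 [H2 [H3 H4]]]; [split; lra|].
      destruct (Hsp x (t - y)) as [G1 [G2 [G3 G4]]]; [split; lra|].
      unfold g. refine (conj _ (conj _ (conj _ _))).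
      + apply (is_derive_minus (fun z => u z (t + y)) (fun z => u z (t - y))); assumption.
      + replace (uy x (t + y) + uy x (t - y)) with (uy x (t + y) - - uy x (t - y)) by ring.
        apply (is_derive_minus (fun z => u x (t + z)) (fun z => u x (t - z)));
          [apply (is_derive_shift (u x)), H2|apply (is_derive_reflect (u x)), G2].
      + apply (is_derive_minus (fun z => ux z (t + y)) (fun z => ux z (t - y))); assumption.
      + replace (uyy x (t + y) - uyy x (t - y)) with (uyy x (t + y) + - uyy x (t - y)) by ring.
        apply (is_derive_plus (fun z => uy x (t + z)) (fun z => uy x (t - z)));
          [apply (is_derive_shift (uy x)), H4|apply (is_derive_reflect (uy x)), G4].
    - intros x y [Hx Hy].
      assert (H1 := Hlap x (t + y)). assert (H2 := Hlap x (t - y)).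
      assert (H3 : open_box (a - d) (a + d) (t - d) (t + d) x (t + y)) by (split; lra).
      assert (H4 : open_box (a - d) (a + d) (t - d) (t + d) x (t - y)) by (split; lra).
      specialize (H1 H3). specialize (H2 H4). apply Rabs_def2 in H1, H2. apply Rabs_def1; lra.
    - intros x y [Hx Hy]; simpl in *. unfold g.
      assert (H1 := HM x (t + y)). assert (H2 := HM x (t - y)).
      assert (H3 : closed_box (a - d) (a + d) (t - d) (t + d) (x, t + y)) by (split; simpl; lra).
      assert (H4 : closed_box (a - d) (a + d) (t - d) (t + d) (x, t - y)) by (split; simpl; lra).
      specialize (H1 H3). specialize (H2 H4). apply Rabs_le_between in H1, H2. apply Rabs_le; lra.
    - intros x Hx. unfold g. replace (t - 0) with t by ring. replace (t + 0) with t by ring. ring. }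
  assert (Hder : is_derive (g a) 0 (2 * uy a t)).
  { destruct (Hsp a t) as [_ [H2 _]]; [split; lra|].
    unfold g. replace (2 * uy a t) with (uy a t - - uy a t) by ring.
    apply (is_derive_minus (fun z => u a (t + z)) (fun z => u a (t - z)));
      [apply (is_derive_shift (u a)); rewrite Rplus_0_r
      |apply (is_derive_reflect (u a)); rewrite Rminus_0_r]; exact H2. }
  apply is_derive_Reals in Hder.
  assert (Hg0 : g a 0 = 0).
  { unfold g. rewrite Rplus_0_r, Rminus_0_r. ring. }
  (* With the excess [2 * (Rabs (uy a t) - K)] as tolerance, difference quotients of [g a] near 0
     would exceed [2 * K] in absolute value, against the barrier bound. *)
  apply Rnot_lt_le. intros Hlt.
  destruct (Hder (2 * (Rabs (uy a t) - K))) as [[e He] H]; [lra|]. simpl in H.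
  set (s := Rmin e d / 2).
  assert (Hs : 0 < s < e /\ s < d).
  { unfold s. pose proof (Rmin_glb_lt e d 0 He Hd).
    pose proof (Rmin_l e d). pose proof (Rmin_r e d). lra. }
  specialize (H s ltac:(lra)). rewrite (Rabs_right s) in H by lra. specialize (H ltac:(lra)).
  specialize (Hg s ltac:(lra)). rewrite Rplus_0_l, Hg0, Rminus_0_r in H.
  assert (Hq : Rabs (g a s / s) <= 2 * K).
  { unfold Rdiv. rewrite Rabs_mult, Rabs_inv, (Rabs_right s) by lra.
    apply Rmult_le_reg_r with s; [lra|]. rewrite Rmult_assoc, Rinv_l by lra. lra. }
  assert (Ht : Rabs (2 * uy a t) = 2 * Rabs (uy a t)).
  { rewrite Rabs_mult, (Rabs_right 2); lra. }
  pose proof (Rabs_triang_inv (2 * uy a t) (g a s / s)) as Htri.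
  rewrite (Rabs_minus_sym (2 * uy a t)) in Htri. lra.
Qed.

Lemma interior_gradient_bound (a t d M N : R) (u ux uy uxx uyy : R -> R -> R) :
  0 < d -> 0 <= M -> 0 <= N ->
  continuous_on (closed_box (a - d) (a + d) (t - d) (t + d)) (uncurry2 u) ->
  second_partials (open_box (a - d) (a + d) (t - d) (t + d)) u ux uy uxx uyy ->
  (forall x y, open_box (a - d) (a + d) (t - d) (t + d) x y ->
     Rabs (uxx x y + uyy x y) < N) ->
  (forall x y, closed_box (a - d) (a + d) (t - d) (t + d) (x, y) ->
     Rabs (u x y) <= M) ->
  Rabs (ux a t) <= 2 * M / d + N * d / 2 /\ Rabs (uy a t) <= 2 * M / d + N * d / 2.
Proof.
  intros Hd HM0 HN Hc Hsp Hlap HM. split.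
  2:{ apply (interior_dy_bound a t d M N u ux uy uxx uyy); assumption. }
  (* The Laplacian is symmetric in the coordinates, so [ux] is estimated as the second partial
     derivative of the transposed function. *)
  apply (interior_dy_bound t a d M N (fun x y => u y x) (fun x y => uy y x)
    (fun x y => ux y x) (fun x y => uyy y x) (fun x y => uxx y x)); try assumption.
  - apply (continuous_on_comp (U := prod_UniformSpace R_UniformSpace R_UniformSpace)
      _ _ (uncurry2 u) (fun p : R * R => (snd p, fst p))) with (3 := Hc).
    + intros p _. apply continuous_pair; [apply continuous_snd|apply continuous_fst].
    + intros p [Hp1 Hp2]. split; assumption.
  - intros x y [Hx Hy]. destruct (Hsp y x) as [H1 [H2 [H3 H4]]]; [split; assumption|].
    exact (conj H2 (conj H1 (conj H4 H3))).
  - intros x y [Hx Hy]. rewrite Rplus_comm. apply Hlap. split; assumption.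
  - intros x y [Hx Hy]. apply HM. split; assumption.
Qed.

(* Near the flat boundary [u] is bounded by a multiple of the height, which
   compensates the factor [1 / height] of the interior estimate. *)
Lemma half_plane_gradient_bound (a t M N : R) (u ux uy uxx uyy : R -> R -> R) :
  0 < t -> 0 <= M -> 0 <= N ->
  continuous_on (closed_box (a - 1) (a + 1) 0 (t + 1)) (uncurry2 u) ->
  second_partials (open_box (a - 1) (a + 1) 0 (t + 1)) u ux uy uxx uyy ->
  (forall x y, open_box (a - 1) (a + 1) 0 (t + 1) x y -> Rabs (uxx x y + uyy x y) < N) ->
  (forall x y, closed_box (a - 1) (a + 1) 0 (t + 1) (x, y) -> Rabs (u x y) <= M) ->
  (forall x, a - 1 <= x <= a + 1 -> u x 0 = 0) ->
  Rabs (ux a t) <= 16 * M + 4 * N /\ Rabs (uy a t) <= 16 * M + 4 * N.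
Proof.
  intros Ht HM0 HN Hc Hsp Hlap HM Hbot.
  assert (Hcsub : forall a' b' c' d', a - 1 <= a' -> b' <= a + 1 -> 0 <= c' -> d' <= t + 1 ->
    continuous_on (closed_box a' b' c' d') (uncurry2 u) /\
    second_partials (open_box a' b' c' d') u ux uy uxx uyy /\
    (forall x y, open_box a' b' c' d' x y -> Rabs (uxx x y + uyy x y) < N) /\
    (forall x y, closed_box a' b' c' d' (x, y) -> Rabs (u x y) <= M)).
  { intros a' b' c' d' H1 H2 H3 H4. split; [|split; [|split]].
    - apply continuous_on_subset with (2 := Hc). intros p [Hp1 Hp2]. split; lra.
    - intros x y [Hx Hy]. apply Hsp. split; lra.
    - intros x y [Hx Hy]. apply Hlap. split; lra.
    - intros x y [Hx Hy]. apply HM. simpl in *. split; simpl; lra. }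
  (* From height 1/4 on, a square of half-side 1/4 fits into the half-plane. Below it the square of
     half-side [t] touches the boundary but stays under height 1/2, where barriers on boxes of
     half-width 1/2 give [Rabs (u x y) <= y * K]. *)
  destruct (Rle_or_lt (1 / 4) t) as [H|H].
  - destruct (Hcsub (a - 1 / 4) (a + 1 / 4) (t - 1 / 4) (t + 1 / 4))
      as [H1 [H2 [H3 H4]]]; try lra.
    destruct (interior_gradient_bound a t (1 / 4) M N u ux uy uxx uyy); try assumption; lra.
  - set (K := 4 * M + N / 4).
    assert (Hlin : forall x y, a - t <= x <= a + t -> 0 <= y <= 1 / 2 -> Rabs (u x y) <= y * K).
    { intros x y Hx Hy.
      destruct (Hcsub (x - 1 / 2) (x + 1 / 2) 0 (1 / 2)) as [H1 [H2 [H3 H4]]]; try lra.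
      replace K with (2 * M / (1 / 2) + N * (1 / 2) / 2) by (unfold K; field).
      apply (barrier_bound x (1 / 2) M N u ux uy uxx uyy); try assumption; try lra.
      intros; apply Hbot; lra. }
    assert (HK : 0 <= K) by (unfold K; lra).
    destruct (Hcsub (a - t) (a + t) (t - t) (t + t)) as [H1 [H2 [H3 _]]]; try lra.
    (* This fixes the constants of the statement: [4 * K = 16 * M + N], and [N * t / 2] fits into
       the remaining [3 * N]. *)
    assert (Hb : 2 * (2 * t * K) / t + N * t / 2 <= 16 * M + 4 * N).
    { replace (2 * (2 * t * K) / t) with (4 * K) by (field; lra).
      assert (N * t <= N * 1) by (apply Rmult_le_compat_l; lra). unfold K. lra. }
    destruct (interior_gradient_bound a t t (2 * t * K) N u ux uy uxx uyy); try assumption; try lra.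
    + repeat apply Rmult_le_pos; lra.
    + intros x y [Hx Hy]; simpl in *. apply Rle_trans with (y * K); [apply Hlin; lra|].
      apply Rmult_le_compat_r; lra.
Qed.

(** * Geometry far from the origin and differentiability classes *)

Lemma enorm_ge_0 (x : R * R) : 0 <= enorm x.
Proof. apply sqrt_pos. Qed.

Lemma enorm_fst_le (x : R * R) : Rabs (fst x) <= enorm x.
Proof. apply Rle_trans with (2 := Rmax_Cmod x), Rmax_l. Qed.

Lemma enorm_snd_le (x : R * R) : Rabs (snd x) <= enorm x.
Proof. apply Rle_trans with (2 := Rmax_Cmod x), Rmax_r. Qed.

Lemma Cmod_le_abs (z : C) : Cmod z <= Rabs (fst z) + Rabs (snd z).
Proof.
  unfold Cmod. rewrite <- (sqrt_Rsqr (Rabs (fst z) + Rabs (snd z))).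
  - apply sqrt_le_1_alt. unfold Rsqr.
    rewrite <- (pow2_abs (fst z)), <- (pow2_abs (snd z)).
    pose proof (Rmult_le_pos _ _ (Rabs_pos (fst z)) (Rabs_pos (snd z))). nra.
  - pose proof (Rabs_pos (fst z)). pose proof (Rabs_pos (snd z)). lra.
Qed.

Lemma enorm_le_abs (x : R * R) : enorm x <= Rabs (fst x) + Rabs (snd x).
Proof. exact (Cmod_le_abs x). Qed.

Lemma enorm_sub_le (p q : R * R) :
  enorm p - Rabs (fst q - fst p) - Rabs (snd q - snd p) <= enorm q.
Proof.
  assert (H : Cmod p <= Cmod q + Cmod (p - q)%C).
  { eapply Rle_trans; [|apply Cmod_triangle]. apply Req_le, f_equal, injective_projections; simpl; ring. }
  pose proof (Cmod_le_abs (p - q)%C) as H1. simpl in H1.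
  change (enorm p) with (Cmod p). change (enorm q) with (Cmod q).
  rewrite (Rabs_minus_sym (fst q)), (Rabs_minus_sym (snd q)).
  unfold Rminus. lra.
Qed.

Lemma C2_line_continuous (h : R -> R) (t : R) : C2_line h -> continuous h t.
Proof.
  intros Hh. apply (ex_derive_continuous (K := R_AbsRing) (V := R_NormedModule) h), (Hh t).
Qed.

(** Distance is measured by the norm and not by the abscissa: over the support of [h] a large norm
    forces a large ordinate in absolute value, so the graph and the flat line separate the same
    points there too. *)
Definition flat_outside (h : R -> R) (R0 : R) : Prop :=
  0 < R0 /\ forall x, R0 <= enorm x ->
    (h (fst x) < snd x <-> 0 < snd x) /\ (snd x = h (fst x) <-> snd x = 0).

Lemma surface_flat_at_infinity (h : R -> R) :
  C2_line h -> compact_support h -> exists R0, flat_outside h R0.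
Proof.
  intros Hh Hsupp.
  destruct (compact_P1 _ Hsupp) as [m [M HmM]].
  set (rho := Rabs m + Rabs M).
  pose proof (Rabs_pos m) as Hm. pose proof (Rabs_pos M) as HM.
  assert (H0 : forall t, rho < Rabs t -> h t = 0).
  { intros t Ht. apply NNPP. intros Hne.
    destruct (HmM t (adherence_P1 (fun t => h t <> 0) t Hne)) as [H1 H2].
    unfold rho in Ht. unfold Rabs in *.
    destruct (Rcase_abs m), (Rcase_abs M), (Rcase_abs t); lra. }
  assert (Hcont : forall t, - rho <= t <= rho -> continuity_pt h t).
  { intros t _. apply continuity_pt_filterlim, C2_line_continuous, Hh. }
  destruct (continuity_ab_maj h (- rho) rho) as [p [Hp _]]; [unfold rho; lra|exact Hcont|].
  destruct (continuity_ab_min h (- rho) rho) as [q [Hq _]]; [unfold rho; lra|exact Hcont|].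
  set (H := Rabs (h p) + Rabs (h q)).
  (* [rho] bounds the support and [H] the values of [h] on [[- rho, rho]]. If the abscissa lies in
     that interval, the norm bound leaves more than [H] for the absolute value of the ordinate. *)
  exists (rho + H + 1). unfold H.
  pose proof (Rabs_pos (h p)). pose proof (Rabs_pos (h q)).
  split; [unfold rho; lra|]. intros [x y] Hxy. cbn [fst snd].
  pose proof (enorm_le_abs (x, y)) as Hle. cbn [fst snd] in Hle.
  destruct (Rle_or_lt (Rabs x) rho) as [Hx|Hx].
  - assert (Hy : Rabs (h p) + Rabs (h q) < Rabs y) by lra.
    apply Rabs_le_between in Hx. specialize (Hp x Hx). specialize (Hq x Hx).
    unfold Rabs in *. destruct (Rcase_abs (h p)), (Rcase_abs (h q)), (Rcase_abs y);
      split; split; lra.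
  - rewrite (H0 x Hx). tauto.
Qed.

Lemma Derive_translate (f : R -> R) (m x : R) :
  Derive (fun z => f (z + m)) x = Derive f (x + m).
Proof.
  unfold Derive. f_equal. apply Lim_ext. intros z.
  replace (x + z + m) with (x + m + z) by ring. reflexivity.
Qed.

Lemma continuity_2d_pt_translate (f : R -> R -> R) (m x y : R) :
  continuity_2d_pt f (x + m) y -> continuity_2d_pt (fun u v => f (u + m) v) x y.
Proof.
  intros H eps. destruct (H eps) as [e He]. exists e. intros u v Hu Hv.
  apply He; [|exact Hv]. replace (u + m - (x + m)) with (u - x) by ring. exact Hu.
Qed.

Lemma ex_diff_n_translate (n : nat) (f : R -> R -> R) (m x y : R) :
  ex_diff_n f n (x + m) y -> ex_diff_n (fun u v => f (u + m) v) n x y.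
Proof.
  revert f. induction n as [|n IH]; intros f H.
  - split; [apply continuity_2d_pt_translate, H|exact I].
  - destruct H as [H1 [H2 [H3 [H4 H5]]]].
    refine (conj _ (conj _ (conj _ (conj _ _)))).
    + apply continuity_2d_pt_translate, H1.
    + apply (ex_derive_comp (fun z => f z y) (fun z => z + m)); [exact H2|auto_derive; auto].
    + exact H3.
    + apply ex_diff_n_ext_loc with (2 := IH _ H4).
      apply locally_2d_forall. intros u v. symmetry.
      apply (Derive_translate (fun z => f z v)).
    + exact (IH _ H5).
Qed.

Lemma ex_diff_n_derive (n : nat) (f : R -> R -> R) (x y : R) :
  ex_diff_n f (S n) x y ->
  ex_derive (fun z => f z y) x /\ ex_derive (fun z => f x z) y.
Proof. intros [_ [H1 [H2 _]]]. exact (conj H1 H2). Qed.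

Lemma is_derive_lin (f g : R -> R) (a b x l m : R) :
  is_derive f x l -> is_derive g x m ->
  is_derive (fun z => a * f z + b * g z) x (a * l + b * m).
Proof.
  intros Hf Hg. apply (is_derive_plus (fun z => a * f z) (fun z => b * g z));
    apply is_derive_scal; assumption.
Qed.

Lemma ex_derive_lin (f g : R -> R) (a b x : R) :
  ex_derive f x -> ex_derive g x -> ex_derive (fun z => a * f z + b * g z) x.
Proof.
  intros [l Hl] [m Hm]. exists (a * l + b * m). apply is_derive_lin; assumption.
Qed.

Lemma Derive_lin (f g : R -> R) (a b x : R) :
  ex_derive f x -> ex_derive g x ->
  Derive (fun z => a * f z + b * g z) x = a * Derive f x + b * Derive g x.
Proof.
  intros Hf Hg. apply is_derive_unique, is_derive_lin; apply Derive_correct; assumption.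
Qed.

(** [Derive] is total and known to be linear only where both functions are differentiable, so the
    induction needs differentiability on a neighbourhood; hence the open set [D]. The lemma serves
    multiplication by a complex constant, which mixes real and imaginary parts. *)
Lemma ex_diff_n_lin (n : nat) (D : R -> R -> Prop) (f g : R -> R -> R) (a b : R) :
  (forall x y, D x y -> locally_2d D x y) ->
  (forall x y, D x y -> ex_diff_n f n x y) -> (forall x y, D x y -> ex_diff_n g n x y) ->
  forall x y, D x y -> ex_diff_n (fun u v => a * f u v + b * g u v) n x y.
Proof.
  intros HD. revert f g. induction n as [|n IH]; intros f g Hf Hg x y Hxy;
    assert (Hc : continuity_2d_pt (fun u v => a * f u v + b * g u v) x y)
      by (apply continuity_2d_pt_plus; apply continuity_2d_pt_mult;
          try apply continuity_2d_pt_const; [apply (Hf x y Hxy)|apply (Hg x y Hxy)]).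
  - exact (conj Hc I).
  - assert (Hf' : forall x y, D x y -> ex_derive (fun z => f z y) x /\ ex_derive (fun z => f x z) y)
      by (intros u v Huv; apply (ex_diff_n_derive n), Hf, Huv).
    assert (Hg' : forall x y, D x y -> ex_derive (fun z => g z y) x /\ ex_derive (fun z => g x z) y)
      by (intros u v Huv; apply (ex_diff_n_derive n), Hg, Huv).
    refine (conj Hc (conj _ (conj _ (conj _ _)))).
    + apply (ex_derive_lin (fun z => f z y) (fun z => g z y));
        [exact (proj1 (Hf' x y Hxy))|exact (proj1 (Hg' x y Hxy))].
    + apply (ex_derive_lin (fun z => f x z) (fun z => g x z));
        [exact (proj2 (Hf' x y Hxy))|exact (proj2 (Hg' x y Hxy))].
    + apply ex_diff_n_ext_loc with (fun u v => a * Derive (fun z => f z v) u + b * Derive (fun z => g z v) u).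
      * apply locally_2d_impl with (2 := HD x y Hxy). apply locally_2d_forall. intros u v Huv.
        symmetry. apply (Derive_lin (fun z => f z v) (fun z => g z v));
          [exact (proj1 (Hf' u v Huv))|exact (proj1 (Hg' u v Huv))].
      * apply IH; [| |exact Hxy]; intros u v Huv; [apply (Hf u v Huv)|apply (Hg u v Huv)].
    + apply ex_diff_n_ext_loc with (fun u v => a * Derive (fun z => f u z) v + b * Derive (fun z => g u z) v).
      * apply locally_2d_impl with (2 := HD x y Hxy). apply locally_2d_forall. intros u v Huv.
        symmetry. apply (Derive_lin (fun z => f u z) (fun z => g u z));
          [exact (proj2 (Hf' u v Huv))|exact (proj2 (Hg' u v Huv))].
      * apply IH; [| |exact Hxy]; intros u v Huv; [apply (Hf u v Huv)|apply (Hg u v Huv)].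
Qed.

Definition d1 (u : R -> R -> R) (x y : R) : R := Derive (fun z => u z y) x.
Definition d2 (u : R -> R -> R) (x y : R) : R := Derive (fun z => u x z) y.

Lemma ex_diff_2_second_partials (D : R -> R -> Prop) (u : R -> R -> R) :
  (forall x y, D x y -> ex_diff_n u 2 x y) ->
  second_partials D u (d1 u) (d2 u) (d1 (d1 u)) (d2 (d2 u)).
Proof.
  intros H x y Hxy. destruct (H x y Hxy) as [_ [H1 [H2 [[_ [H3 _]] [_ [_ [H4 _]]]]]]].
  refine (conj _ (conj _ (conj _ _))); apply Derive_correct; assumption.
Qed.

(** The way back from explicit derivatives to iterated [Derive]: the outer derivative sees the inner
    one on a neighbourhood, where openness of [D] allows replacing it by [ux] or [uy]. *)
Lemma second_partials_Derive (D : R -> R -> Prop) (u ux uy uxx uyy : R -> R -> R) (x y : R) :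
  (forall x y, D x y -> locally_2d D x y) ->
  second_partials D u ux uy uxx uyy -> D x y ->
  d1 (d1 u) x y = uxx x y /\ d2 (d2 u) x y = uyy x y.
Proof.
  intros HD H Hxy. pose proof (HD x y Hxy) as Hloc. split.
  - transitivity (Derive (fun z => ux z y) x); [|apply is_derive_unique, (H x y Hxy)].
    apply Derive_ext_loc. apply filter_imp with (2 := locally_2d_1d_const_y _ _ _ Hloc).
    intros z Hz. apply is_derive_unique, (H z y Hz).
  - transitivity (Derive (fun z => uy x z) y); [|apply is_derive_unique, (H x y Hxy)].
    apply Derive_ext_loc. apply filter_imp with (2 := locally_2d_1d_const_x _ _ _ Hloc).
    intros z Hz. apply is_derive_unique, (H x z Hz).
Qed.

Lemma second_partials_lin (D : R -> R -> Prop) (a b : R)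
    (u ux uy uxx uyy v vx vy vxx vyy : R -> R -> R) :
  second_partials D u ux uy uxx uyy -> second_partials D v vx vy vxx vyy ->
  second_partials D (fun x y => a * u x y + b * v x y) (fun x y => a * ux x y + b * vx x y)
    (fun x y => a * uy x y + b * vy x y) (fun x y => a * uxx x y + b * vxx x y)
    (fun x y => a * uyy x y + b * vyy x y).
Proof.
  intros Hu Hv x y Hxy.
  destruct (Hu x y Hxy) as [H1 [H2 [H3 H4]]]. destruct (Hv x y Hxy) as [G1 [G2 [G3 G4]]].
  refine (conj _ (conj _ (conj _ _))).
  - apply (is_derive_lin (fun z => u z y) (fun z => v z y)); assumption.
  - apply (is_derive_lin (fun z => u x z) (fun z => v x z)); assumption.
  - apply (is_derive_lin (fun z => ux z y) (fun z => vx z y)); assumption.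
  - apply (is_derive_lin (fun z => uy x z) (fun z => vy x z)); assumption.
Qed.

Lemma is_derive_translate (f : R -> R) (m x l : R) :
  is_derive f (x + m) l -> is_derive (fun z => f (z + m)) x l.
Proof.
  intros H. replace l with (scal 1 l) by apply Rmult_1_l.
  apply (is_derive_comp f (fun z => z + m)); [exact H|]. auto_derive; auto.
Qed.

Lemma second_partials_translate (D : R -> R -> Prop) (m : R) (u ux uy uxx uyy : R -> R -> R) :
  second_partials D u ux uy uxx uyy ->
  second_partials (fun x y => D (x + m) y) (fun x y => u (x + m) y) (fun x y => ux (x + m) y)
    (fun x y => uy (x + m) y) (fun x y => uxx (x + m) y) (fun x y => uyy (x + m) y).
Proof.
  intros H x y Hxy. destruct (H (x + m) y Hxy) as [H1 [H2 [H3 H4]]].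
  refine (conj _ (conj _ (conj _ _))).
  - apply (is_derive_translate (fun z => u z y)), H1.
  - exact H2.
  - apply (is_derive_translate (fun z => ux z y)), H3.
  - exact H4.
Qed.

(** Total differentiability follows from one partial derivative that exists nearby and is continuous
    at the point, together with the other one at the point. It is what the chain rule along a ray
    requires. *)
Lemma ex_diff_2_differentiable (D : R -> R -> Prop) (u : R -> R -> R) (x y : R) :
  (forall x y, D x y -> locally_2d D x y) ->
  (forall x y, D x y -> ex_diff_n u 2 x y) -> D x y ->
  differentiable_pt_lim u x y (d1 u x y) (d2 u x y).
Proof.
  intros HD Hu Hxy. apply filterdiff_differentiable_pt_lim.
  apply (is_derive_filterdiff u x y (d1 u) (d2 u x y)).
  - apply (locally_2d_locally (fun a b => is_derive (fun z => u z b) a (d1 u a b))).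
    apply locally_2d_impl with (2 := HD x y Hxy). apply locally_2d_forall. intros a b Hab.
    apply Derive_correct, (Hu a b Hab).
  - apply Derive_correct, (Hu x y Hxy).
  - apply (continuity_2d_pt_filterlim (d1 u)). apply (Hu x y Hxy).
Qed.

Lemma is_derive_along_ray (u : R -> R -> R) (p1 p2 e1 e2 r l1 l2 : R) :
  differentiable_pt_lim u (p1 + r * e1) (p2 + r * e2) l1 l2 ->
  is_derive (fun s => u (p1 + s * e1) (p2 + s * e2)) r (l1 * e1 + l2 * e2).
Proof.
  intros H. apply is_derive_Reals.
  apply (derivable_pt_lim_comp_2d u (fun s => p1 + s * e1) (fun s => p2 + s * e2)); [exact H| |];
    apply is_derive_Reals; auto_derive; auto; ring.
Qed.

(** * Bounds on the scattered field at infinity *)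

Lemma expi_add (a b : R) : expi (a + b) = (expi a * expi b)%C.
Proof.
  unfold expi. rewrite cos_plus, sin_plus. apply injective_projections; simpl; ring.
Qed.

Lemma Cmod_expi (a : R) : Cmod (expi a) = 1.
Proof.
  unfold Cmod, expi. cbn [fst snd]. rewrite <- sqrt_1. f_equal.
  rewrite <- (sin2_cos2 a). unfold Rsqr. ring.
Qed.

Lemma domain_above_surface (h : R -> R) (x : R * R) :
  domain_above (surface h) x <-> h (fst x) < snd x.
Proof.
  split.
  - intros [t [H1 H2]]. unfold surface in H1. simpl in H1. lra.
  - intros H. exists (h (fst x)). split; [reflexivity|exact H].
Qed.

Lemma closed_domain_above_surface (h : R -> R) (x : R * R) :
  closed_domain_above (surface h) x <-> h (fst x) <= snd x.
Proof.
  unfold closed_domain_above. rewrite domain_above_surface. unfold surface. lra.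
Qed.

Lemma shifted_surface_translate (l : R) (h : R -> R) (y : R * R) :
  shifted_surface l h y <-> surface h (translate1 (- l) y).
Proof.
  unfold shifted_surface, surface, translate1. simpl. split.
  - intros [t ->]. simpl. f_equal. ring.
  - intros H. exists (fst y + - l). apply injective_projections; simpl; [ring|exact H].
Qed.

Lemma domain_above_shifted (l : R) (h : R -> R) (y : R * R) :
  domain_above (shifted_surface l h) y <-> domain_above (surface h) (translate1 (- l) y).
Proof.
  unfold domain_above. split; intros [t [H1 H2]]; exists t.
  - apply shifted_surface_translate in H1. split; assumption.
  - split; [apply shifted_surface_translate; exact H1|exact H2].
Qed.

Lemma closed_domain_above_shifted (l : R) (h : R -> R) (y : R * R) :
  closed_domain_above (shifted_surface l h) y <->
  closed_domain_above (surface h) (translate1 (- l) y).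
Proof.
  unfold closed_domain_above. rewrite domain_above_shifted, shifted_surface_translate. tauto.
Qed.

Lemma epigraph_open (h : R -> R) (x y : R) :
  C2_line h -> h x < y -> locally_2d (fun u v => h u < v) x y.
Proof.
  intros Hh Hxy.
  destruct (C2_line_continuous h x Hh (ball (h x) (mkposreal ((y - h x) / 2) ltac:(lra)))
    (locally_ball _ _)) as [e He].
  assert (Hpos : 0 < Rmin e ((y - h x) / 2)) by (apply Rmin_glb_lt; [apply cond_pos|lra]).
  exists (mkposreal _ Hpos). simpl. intros u v Hu Hv.
  pose proof (Rmin_l e ((y - h x) / 2)). pose proof (Rmin_r e ((y - h x) / 2)).
  specialize (He u). unfold ball in He; simpl in He; unfold AbsRing_ball, abs, minus, plus, opp in He;
    simpl in He.
  assert (H1 : Rabs (h u + - h x) < (y - h x) / 2) by (apply He; unfold Rminus in *; lra).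
  apply Rabs_def2 in H1. apply Rabs_def2 in Hv. lra.
Qed.

Lemma flat_outside_le (h : R -> R) (R0 : R) (x : R * R) :
  flat_outside h R0 -> R0 <= enorm x -> (h (fst x) <= snd x <-> 0 <= snd x).
Proof. intros [_ H] Hx. specialize (H x Hx). lra. Qed.

(** All boxes have half-width 1 whatever the point, so one constant serves the whole region. The
    margin 2 in the radius keeps them beyond [R0]: the norm drops by at most the sum of the two
    coordinate changes. *)
Lemma far_gradient_bound (h : R -> R) (R0 M k : R) (u : R -> R -> R) :
  flat_outside h R0 -> 0 <= M ->
  continuous_on (closed_domain_above (surface h)) (uncurry2 u) ->
  (forall x y, h x < y -> ex_diff_n u 2 x y) ->
  (forall x y, h x < y -> d1 (d1 u) x y + d2 (d2 u) x y = - k ^ 2 * u x y) ->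
  (forall x y, R0 <= enorm (x, y) -> 0 <= y -> Rabs (u x y) <= M) ->
  (forall x, R0 <= enorm (x, 0) -> u x 0 = 0) ->
  exists G, 0 <= G /\ forall x y, R0 + 2 <= enorm (x, y) -> 0 < y ->
    Rabs (d1 u x y) <= G /\ Rabs (d2 u x y) <= G.
Proof.
  intros Hflat HM Hc Hdiff Hhelm Hbd Hzero.
  (* The summand 1 turns the bound [k ^ 2 * M] on the Laplacian into a strict one. *)
  set (N := k ^ 2 * M + 1).
  assert (Hk : 0 <= k ^ 2 * M) by (apply Rmult_le_pos; [apply pow2_ge_0|exact HM]).
  exists (16 * M + 4 * N). split; [unfold N; lra|]. intros a t Hat Ht.
  assert (Hin : forall c d, t - 1 <= c -> 0 <= c -> d <= t + 1 ->
    continuous_on (closed_box (a - 1) (a + 1) c d) (uncurry2 u) /\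
    second_partials (open_box (a - 1) (a + 1) c d) u (d1 u) (d2 u) (d1 (d1 u)) (d2 (d2 u)) /\
    (forall x y, open_box (a - 1) (a + 1) c d x y -> Rabs (d1 (d1 u) x y + d2 (d2 u) x y) < N) /\
    (forall x y, closed_box (a - 1) (a + 1) c d (x, y) -> R0 <= enorm (x, y) /\ Rabs (u x y) <= M)).
  { intros c d Hc1 Hc2 Hd.
    assert (Hfar : forall x y, closed_box (a - 1) (a + 1) c d (x, y) -> R0 <= enorm (x, y)).
    { intros x y [Hx Hy]. pose proof (enorm_sub_le (a, t) (x, y)) as H. cbn [fst snd] in *.
      assert (Rabs (x - a) <= 1) by (apply Rabs_le; lra).
      assert (Rabs (y - t) <= 1) by (apply Rabs_le; lra). lra. }
    assert (Hopen : forall x y, open_box (a - 1) (a + 1) c d x y -> R0 <= enorm (x, y) /\ h x < y).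
    { intros x y [Hx Hy].
      assert (Hxy : R0 <= enorm (x, y)) by (apply Hfar; split; simpl; lra).
      split; [exact Hxy|]. apply (proj2 Hflat (x, y) Hxy). simpl; lra. }
    split; [|split; [|split]].
    - apply continuous_on_subset with (2 := Hc). intros [x y] Hp.
      apply closed_domain_above_surface, (flat_outside_le h R0); auto.
      destruct Hp as [_ Hy]. cbn [fst snd] in *. lra.
    - apply ex_diff_2_second_partials. intros x y Hxy. apply Hdiff, Hopen, Hxy.
    - intros x y Hxy. destruct (Hopen x y Hxy) as [H1 H2].
      rewrite Hhelm by exact H2. rewrite Rabs_mult, Rabs_Ropp, (Rabs_right (k ^ 2)).
      2:{ apply Rle_ge, pow2_ge_0. }
      assert (k ^ 2 * Rabs (u x y) <= k ^ 2 * M).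
      { apply Rmult_le_compat_l; [apply pow2_ge_0|]. apply Hbd; [exact H1|].
        destruct Hxy; lra. }
      unfold N. lra.
    - intros x y Hxy. split; [auto|]. apply Hbd; [auto|]. destruct Hxy; simpl in *; lra. }
  destruct (Rle_or_lt t 1) as [H|H].
  - destruct (Hin 0 (t + 1)) as [H1 [H2 [H3 H4]]]; try lra.
    apply (half_plane_gradient_bound a t M N u _ _ (d1 (d1 u)) (d2 (d2 u))); auto; try (unfold N; lra).
    + intros x y Hxy. apply H4, Hxy.
    + intros x Hx. apply Hzero, H4. split; simpl; lra.
  - destruct (Hin (t - 1) (t + 1)) as [H1 [H2 [H3 H4]]]; try lra.
    destruct (interior_gradient_bound a t 1 M N u (d1 u) (d2 u) (d1 (d1 u)) (d2 (d2 u)))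
      as [G1 G2]; auto; try (unfold N; lra).
    + intros x y Hxy. apply H4, Hxy.
    + assert (0 <= N) by (unfold N; lra). lra.
Qed.

Lemma continuous_on_postcomp {T U V : UniformSpace} (D : T -> Prop) (f : T -> U) (g : U -> V) :
  (forall y, continuous g y) -> continuous_on D f -> continuous_on D (fun x => g (f x)).
Proof.
  intros Hg Hf x Hx. apply filterlim_comp with (1 := Hf x Hx). apply Hg.
Qed.

Lemma continuous_on_Re {T : UniformSpace} (D : T -> Prop) (u : T -> C) :
  continuous_on D u -> continuous_on D (fun x => Re (u x)).
Proof.
  apply (continuous_on_postcomp (U := prod_UniformSpace R_UniformSpace R_UniformSpace) D u (fun z => fst z)).
  intros y. apply continuous_fst.
Qed.

Lemma continuous_on_Im {T : UniformSpace} (D : T -> Prop) (u : T -> C) :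
  continuous_on D u -> continuous_on D (fun x => Im (u x)).
Proof.
  apply (continuous_on_postcomp (U := prod_UniformSpace R_UniformSpace R_UniformSpace) D u (fun z => snd z)).
  intros y. apply continuous_snd.
Qed.

Lemma enorm_sqr (x : R * R) : enorm x * enorm x = fst x ^ 2 + snd x ^ 2.
Proof.
  unfold enorm. apply sqrt_sqrt. pose proof (pow2_ge_0 (fst x)). pose proof (pow2_ge_0 (snd x)). lra.
Qed.

Lemma enorm_vscale (r : R) (x : R * R) : 0 <= r -> enorm (vscale r x) = r * enorm x.
Proof.
  intros Hr. unfold enorm, vscale. cbn [fst snd].
  replace ((r * fst x) ^ 2 + (r * snd x) ^ 2) with (r ^ 2 * (fst x ^ 2 + snd x ^ 2)) by ring.
  rewrite sqrt_mult_alt by apply pow2_ge_0. rewrite sqrt_pow2 by exact Hr. reflexivity.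
Qed.

(* The semicircle is parametrised by its abscissa [R * c]; beyond [|c| = 1] the
   square root is [0] and the curve continues along the flat boundary. *)
Lemma semicircle_bound (h : R -> R) (R0 r : R) (g : R * R -> R) :
  flat_outside h R0 -> R0 <= r ->
  continuous_on (closed_domain_above (surface h)) g ->
  exists M, 0 <= M /\ forall e, enorm e = 1 -> 0 <= snd e -> Rabs (g (vscale r e)) <= M.
Proof.
  intros Hflat Hr Hg.
  assert (Hr0 : 0 < r) by (destruct Hflat; lra).
  pose (gam := fun c : R => (r * c, r * sqrt (1 - c * c))).
  assert (Hgam : forall c, continuous gam c).
  { intros c. apply continuous_pair.
    - apply (ex_derive_continuous (fun c => r * c)). auto_derive; auto.
    - apply (continuous_mult (fun _ : R => r) (fun c => sqrt (1 - c * c)));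
        [apply continuous_const|].
      apply (continuous_comp (fun c => 1 - c * c) sqrt); [|apply continuous_sqrt].
      apply (ex_derive_continuous (fun c => 1 - c * c)). auto_derive; auto. }
  assert (Hdom : forall c, closed_domain_above (surface h) (gam c)).
  { intros c. apply closed_domain_above_surface, (flat_outside_le h R0).
    - exact Hflat.
    - apply Rle_trans with (1 := Hr). apply Rsqr_incr_0; [|lra|apply enorm_ge_0].
      unfold Rsqr. rewrite enorm_sqr. unfold gam. cbn [fst snd].
      rewrite Rpow_mult_distr, (Rpow_mult_distr r).
      destruct (Rle_or_lt 0 (1 - c * c)) as [H|H].
      + rewrite pow2_sqrt by exact H. right; ring.
      + rewrite sqrt_neg_0 by lra. nra.
    - apply Rmult_le_pos; [lra|apply sqrt_pos]. }
  destruct (continuity_ab_maj (fun c => Rabs (g (gam c))) (-1) 1) as [m [Hm _]]; [lra| |].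
  { intros c _. apply continuity_pt_filterlim.
    apply (continuous_comp (fun c => g (gam c)) Rabs); [|apply continuous_Rabs].
    apply (continuous_continuous_on (fun _ => True)); [apply filter_true|].
    apply (continuous_on_comp (U := prod_UniformSpace R_UniformSpace R_UniformSpace)
      (closed_domain_above (surface h)) _ g gam); auto. }
  exists (Rabs (g (gam m))). split; [apply Rabs_pos|]. intros [c s] He Hs. cbn [snd] in Hs.
  assert (He2 : 1 = c ^ 2 + s ^ 2) by (pose proof (enorm_sqr (c, s)) as H; rewrite He in H; cbn [fst snd] in H; lra).
  assert (Hcs : vscale r (c, s) = gam c).
  { unfold vscale, gam. cbn [fst snd]. repeat f_equal.
    replace (1 - c * c) with (s ^ 2) by lra. symmetry. apply sqrt_pow2, Hs. }
  rewrite Hcs. apply Hm. nra.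
Qed.

Lemma enorm_unit_vec (x : R * R) : 0 < enorm x -> enorm (unit_vec x) = 1.
Proof.
  intros H. unfold unit_vec. rewrite enorm_vscale by (apply Rlt_le, Rinv_0_lt_compat, H).
  apply Rinv_l. lra.
Qed.

Lemma upper_circle_unit_vec (x : R * R) : 0 < snd x -> upper_circle (unit_vec x).
Proof.
  intros H. pose proof (enorm_snd_le x) as H1. rewrite Rabs_right in H1 by lra.
  split; [apply enorm_unit_vec; lra|]. unfold unit_vec, vscale. simpl.
  apply Rmult_lt_0_compat; [apply Rinv_0_lt_compat|]; lra.
Qed.

Lemma unit_vec_vscale (r : R) (e : R * R) : 0 < r -> enorm e = 1 -> unit_vec (vscale r e) = e.
Proof.
  intros Hr He. unfold unit_vec. rewrite enorm_vscale, He by lra.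
  destruct e as [a b]. unfold vscale. simpl. apply injective_projections; simpl; field; lra.
Qed.

Lemma Cmod_far_factor (t r : R) (z : C) :
  0 < r -> Cmod (expi t / sqrt r * z)%C = / sqrt r * Cmod z.
Proof.
  intros Hr. pose proof (sqrt_lt_R0 r Hr) as Hs.
  rewrite Cmod_mult, Cmod_div, Cmod_expi, Cmod_R, (Rabs_right (sqrt r)) by
    (try lra; intros H; apply RtoC_inj in H; lra). field. lra.
Qed.

Lemma scattered_field_bounded (h : R -> R) (R0 k : R) (us uinf : R * R -> C) :
  flat_outside h R0 ->
  continuous_on (closed_domain_above (surface h)) us ->
  is_far_field k us uinf ->
  (forall x, R0 <= enorm (x, 0) -> us (x, 0) = 0) ->
  exists M R1, 0 <= M /\ R0 <= R1 /\
    forall x, R1 <= enorm x -> 0 <= snd x -> Cmod (us x) <= M.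
Proof.
  intros Hflat Hc [w [C0 [Rf [HRf Hfar]]]] Hzero.
  pose proof (proj1 Hflat) as HR0.
  set (r := R0 + Rf + 1).
  destruct (semicircle_bound h R0 r _ Hflat ltac:(unfold r; lra) (continuous_on_Re _ _ Hc)) as [M1 [HM1 HRe]].
  destruct (semicircle_bound h R0 r _ Hflat ltac:(unfold r; lra) (continuous_on_Im _ _ Hc)) as [M2 [HM2 HIm]].
  assert (Hsr : 0 < sqrt r) by (apply sqrt_lt_R0; unfold r; lra).
  assert (HC0 : forall x, r <= enorm x -> upper_circle (unit_vec x) -> Cmod (w x) <= Rabs C0).
  { intros x Hx Hu. destruct (Hfar x) as [_ H]; [unfold r in *; lra|exact Hu|].
    apply Rle_trans with (1 := H).
    assert (Hex : 1 <= enorm x) by (unfold r in *; lra).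
    apply Rle_trans with (Rabs C0 / enorm x).
    - apply Rmult_le_compat_r; [apply Rlt_le, Rinv_0_lt_compat; lra|apply Rle_abs].
    - apply Rmult_le_reg_r with (enorm x); [lra|]. unfold Rdiv.
      rewrite Rmult_assoc, Rinv_l by lra. pose proof (Rabs_pos C0). nra. }
  (* On the circle of radius [r] the modulus of [uinf e + w] is [sqrt r] times that of [us], which
     [M1 + M2] bounds. [Rabs C0] bounds the remainder because [r] is at least 1. *)
  set (B := sqrt r * (M1 + M2) + Rabs C0).
  assert (Hinf : forall e, upper_circle e -> Cmod (uinf e) <= B).
  { intros e [He He2].
    assert (Hre : enorm (vscale r e) = r) by (rewrite enorm_vscale, He; unfold r; lra).
    assert (Hue : unit_vec (vscale r e) = e) by (apply unit_vec_vscale; [unfold r; lra|exact He]).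
    destruct (Hfar (vscale r e)) as [H _].
    { rewrite Hre. unfold r. lra. }
    { rewrite Hue. split; assumption. }
    specialize (HC0 (vscale r e) ltac:(lra)). rewrite Hue in *. specialize (HC0 (conj He He2)).
    rewrite Hre in H.
    apply (f_equal Cmod) in H. rewrite Cmod_far_factor in H by (unfold r; lra).
    pose proof (Cmod_le_abs (us (vscale r e))) as H1.
    pose proof (HRe e He ltac:(lra)) as H2. pose proof (HIm e He ltac:(lra)) as H3.
    unfold Re, Im in H2, H3.
    assert (H4 : Cmod (uinf e + w (vscale r e)) <= sqrt r * (M1 + M2)).
    { replace (Cmod (uinf e + w (vscale r e))) with (sqrt r * (/ sqrt r * Cmod (uinf e + w (vscale r e)))) by
        (field; lra).
      apply Rmult_le_compat_l; lra. }
    assert (H5 : Cmod (uinf e) <= Cmod (uinf e + w (vscale r e)) + Cmod (w (vscale r e))).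
    { rewrite <- (Cmod_opp (w (vscale r e))). eapply Rle_trans; [|apply Cmod_triangle].
      right. f_equal. ring. }
    unfold B. lra. }
  exists (B + Rabs C0), r.
  assert (HB : 0 <= B).
  { unfold B. pose proof (Rabs_pos C0). apply Rplus_le_le_0_compat; [apply Rmult_le_pos; lra|lra]. }
  pose proof (Rabs_pos C0) as HC0pos.
  split; [lra|]. split; [unfold r; lra|]. intros x Hx [Hx2|Hx2].
  - pose proof (upper_circle_unit_vec x Hx2) as Hu.
    destruct (Hfar x) as [H _]; [unfold r in *; lra|exact Hu|].
    rewrite H, Cmod_far_factor by (unfold r in *; lra).
    assert (1 <= sqrt (enorm x)).
    { rewrite <- sqrt_1. apply sqrt_le_1_alt. unfold r in *; lra. }
    assert (/ sqrt (enorm x) <= 1) by (rewrite <- Rinv_1; apply Rinv_le_contravar; lra).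
    pose proof (Cmod_triangle (uinf (unit_vec x)) (w x)) as H2.
    specialize (Hinf _ Hu). specialize (HC0 x Hx Hu).
    pose proof (Cmod_ge_0 (uinf (unit_vec x) + w x)) as H3.
    apply Rle_trans with (1 * Cmod (uinf (unit_vec x) + w x)); [|lra].
    apply Rmult_le_compat_r; lra.
  (* Horizontal directions lie outside the expansion, but such points are on the flat boundary,
     where the field is 0. *)
  - destruct x as [a b]. cbn [snd] in Hx2. subst b. rewrite Hzero by (unfold r in *; lra).
    rewrite Cmod_0. lra.
Qed.

(** * Translation of the scattering problem *)

Lemma enorm_translate1_le (l : R) (x : R * R) : Rabs (enorm (translate1 l x) - enorm x) <= Rabs l.
Proof.
  pose proof (enorm_sub_le x (translate1 l x)) as H1.
  pose proof (enorm_sub_le (translate1 l x) x) as H2.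
  unfold translate1 in *. cbn [fst snd] in *.
  replace (snd x - snd x) with 0 in * by ring. rewrite Rabs_R0 in *.
  replace (fst x + l - fst x) with l in H1 by ring.
  replace (fst x - (fst x + l)) with (- l) in H2 by ring. rewrite Rabs_Ropp in H2.
  apply Rabs_le. lra.
Qed.

Lemma translate1_opp (l : R) (x : R * R) : translate1 (- l) (translate1 l x) = x.
Proof. destruct x. unfold translate1. simpl. f_equal. ring. Qed.

(** [y / |y| - x / |x| = (y - x) / |y| + x (|x| - |y|) / (|x| |y|)], and each term is at most
    [|l| / |y|]. The first one has no second component, hence the two different constants. *)
Lemma unit_vec_translate1 (l : R) (x y : R * R) :
  y = translate1 l x -> 0 < enorm x -> 0 < enorm y ->
  Rabs (fst (unit_vec y) - fst (unit_vec x)) <= 2 * Rabs l / enorm y /\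
  Rabs (snd (unit_vec y) - snd (unit_vec x)) <= Rabs l / enorm y.
Proof.
  intros Hy Hx0 Hy0.
  pose proof (enorm_translate1_le l x) as Hd. rewrite <- Hy in Hd.
  assert (Hq : forall a, Rabs a <= enorm x ->
    Rabs (a * (enorm x - enorm y) / (enorm x * enorm y)) <= Rabs l / enorm y).
  { intros a Ha. unfold Rdiv.
    rewrite !Rabs_mult, Rabs_inv, (Rabs_right (enorm x * enorm y)) by nra.
    rewrite (Rabs_minus_sym (enorm x)).
    apply Rmult_le_reg_r with (enorm x * enorm y); [nra|].
    replace (Rabs a * Rabs (enorm y - enorm x) * / (enorm x * enorm y) * (enorm x * enorm y))
      with (Rabs a * Rabs (enorm y - enorm x)) by (field; lra).
    replace (Rabs l * / enorm y * (enorm x * enorm y)) with (enorm x * Rabs l) by (field; lra).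
    apply Rmult_le_compat; auto using Rabs_pos. }
  unfold unit_vec, vscale. cbn [fst snd]. split.
  - replace (/ enorm y * fst y - / enorm x * fst x) with
      (l / enorm y + fst x * (enorm x - enorm y) / (enorm x * enorm y)).
    2:{ replace (fst y) with (fst x + l) by (rewrite Hy; reflexivity). field; lra. }
    eapply Rle_trans; [apply Rabs_triang|].
    pose proof (Hq (fst x) (enorm_fst_le x)) as H.
    assert (Rabs (l / enorm y) = Rabs l / enorm y).
    { unfold Rdiv. rewrite Rabs_mult, Rabs_inv, (Rabs_right (enorm y)) by lra. reflexivity. }
    unfold Rdiv in *. lra.
  - replace (/ enorm y * snd y - / enorm x * snd x) with
      (snd x * (enorm x - enorm y) / (enorm x * enorm y)).
    2:{ replace (snd y) with (snd x) by (rewrite Hy; reflexivity). field; lra. }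
    apply Hq, enorm_snd_le.
Qed.

(** The offset [(p1, p2)] and the factor [c] cover two cases: the original field on a ray from the
    origin, and the translated field, whose ray becomes a line through [(- l, 0)] for the original
    one. *)
Lemma DeriveC_along_ray (f : R -> C) (u : R -> R -> C) (c : C) (p1 p2 e1 e2 r a1 a2 b1 b2 : R) :
  (forall s, f s = (c * u (p1 + s * e1)%R (p2 + s * e2)%R)%C) ->
  differentiable_pt_lim (fun x y => Re (u x y)) (p1 + r * e1) (p2 + r * e2) a1 a2 ->
  differentiable_pt_lim (fun x y => Im (u x y)) (p1 + r * e1) (p2 + r * e2) b1 b2 ->
  DeriveC f r = (c * (a1 * e1 + a2 * e2, b1 * e1 + b2 * e2)%R)%C.
Proof.
  intros Hf Ha Hb. apply is_derive_along_ray in Ha. apply is_derive_along_ray in Hb.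
  unfold DeriveC. apply injective_projections; cbn [fst snd]; apply is_derive_unique.
  - apply is_derive_ext with (fun s => fst c * Re (u (p1 + s * e1) (p2 + s * e2))
      + - snd c * Im (u (p1 + s * e1) (p2 + s * e2))).
    { intros s. rewrite Hf. simpl. unfold Re, Im. ring. }
    replace (fst (c * (a1 * e1 + a2 * e2, b1 * e1 + b2 * e2)%R)%C)
      with (fst c * (a1 * e1 + a2 * e2) + - snd c * (b1 * e1 + b2 * e2)) by (simpl; ring).
    apply is_derive_lin; assumption.
  - apply is_derive_ext with (fun s => snd c * Re (u (p1 + s * e1) (p2 + s * e2))
      + fst c * Im (u (p1 + s * e1) (p2 + s * e2))).
    { intros s. rewrite Hf. simpl. unfold Re, Im. ring. }
    replace (snd (c * (a1 * e1 + a2 * e2, b1 * e1 + b2 * e2)%R)%C)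
      with (snd c * (a1 * e1 + a2 * e2) + fst c * (b1 * e1 + b2 * e2)) by (simpl; ring).
    apply is_derive_lin; assumption.
Qed.

Definition translated_field (k l theta : R) (u : R * R -> C) (y : R * R) : C :=
  (expi (k * l * sin theta) * u (translate1 (- l) y))%C.

Lemma Re_helmholtz (k : R) (u : R * R -> C) (x y : R) :
  (laplacian u (x, y) + k ^ 2 * u (x, y))%C = 0 ->
  d1 (d1 (fun s t => Re (u (s, t)))) x y + d2 (d2 (fun s t => Re (u (s, t)))) x y
    = - k ^ 2 * Re (u (x, y)).
Proof.
  intros H. apply (f_equal fst) in H. rewrite <- RtoC_pow in H. cbn in H.
  unfold d1, d2, Re in *. cbn. lra.
Qed.

Lemma Im_helmholtz (k : R) (u : R * R -> C) (x y : R) :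
  (laplacian u (x, y) + k ^ 2 * u (x, y))%C = 0 ->
  d1 (d1 (fun s t => Im (u (s, t)))) x y + d2 (d2 (fun s t => Im (u (s, t)))) x y
    = - k ^ 2 * Im (u (x, y)).
Proof.
  intros H. apply (f_equal snd) in H. rewrite <- RtoC_pow in H. cbn in H.
  unfold d1, d2, Im in *. cbn. lra.
Qed.

(** The incident and the reflected direction share the first component [sin theta], so both waves,
    and with them the Dirichlet data, acquire the same phase factor. *)
Lemma incident_wave_translate1 (k l theta : R) (x : R * R) :
  incident_wave k theta (translate1 l x)
    = (expi (k * l * sin theta) * incident_wave k theta x)%C.
Proof.
  unfold incident_wave. rewrite <- expi_add. f_equal.
  unfold vdot, translate1. simpl. ring.
Qed.

Lemma reflected_wave_translate1 (k l theta : R) (x : R * R) :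
  reflected_wave k theta (translate1 l x)
    = (expi (k * l * sin theta) * reflected_wave k theta x)%C.
Proof.
  unfold reflected_wave.
  replace (k * vdot (sin theta, cos theta) (translate1 l x))
    with (k * l * sin theta + k * vdot (sin theta, cos theta) x)
    by (unfold vdot, translate1; simpl; ring).
  rewrite expi_add. ring.
Qed.

Lemma C2_on_translated (h : R -> R) (k l theta : R) (u : R * R -> C) :
  C2_line h -> C2_on (domain_above (surface h)) u ->
  C2_on (domain_above (shifted_surface l h)) (translated_field k l theta u).
Proof.
  intros Hh Hu [x y] Hxy. apply domain_above_shifted, domain_above_surface in Hxy.
  unfold translate1 in Hxy. cbn [fst snd] in *.
  assert (HD : forall x y, h x < y -> locally_2d (fun x y => h x < y) x y).
  { intros a b. apply epigraph_open, Hh. }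
  assert (HRe : forall a b, h a < b -> ex_diff_n (fun s t => Re (u (s, t))) 2 a b).
  { intros a b Hab. apply (Hu (a, b)), domain_above_surface, Hab. }
  assert (HIm : forall a b, h a < b -> ex_diff_n (fun s t => Im (u (s, t))) 2 a b).
  { intros a b Hab. apply (Hu (a, b)), domain_above_surface, Hab. }
  set (c := expi (k * l * sin theta)). split.
  - apply ex_diff_n_ext_loc with
      (fun s t => fst c * Re (u (s + - l, t)) + - snd c * Im (u (s + - l, t))).
    { apply locally_2d_forall. intros s t. unfold translated_field. fold c. simpl.
      unfold Re, Im, translate1. simpl. ring. }
    apply (ex_diff_n_translate 2 (fun s t => fst c * Re (u (s, t)) + - snd c * Im (u (s, t)))).
    apply (ex_diff_n_lin 2 _ _ _ _ _ HD HRe HIm), Hxy.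
  - apply ex_diff_n_ext_loc with
      (fun s t => snd c * Re (u (s + - l, t)) + fst c * Im (u (s + - l, t))).
    { apply locally_2d_forall. intros s t. unfold translated_field. fold c. simpl.
      unfold Re, Im, translate1. simpl. ring. }
    apply (ex_diff_n_translate 2 (fun s t => snd c * Re (u (s, t)) + fst c * Im (u (s, t)))).
    apply (ex_diff_n_lin 2 _ _ _ _ _ HD HRe HIm), Hxy.
Qed.

Lemma continuous_Cmult_const (c z : C) :
  continuous (T := C_UniformSpace) (U := C_UniformSpace) (fun z => (c * z)%C) z.
Proof.
  apply (continuous_pair (T := C_UniformSpace) (U := R_UniformSpace) (V := R_UniformSpace)
    (fun z => fst c * fst z - snd c * snd z) (fun z => fst c * snd z + snd c * fst z)).
  - apply (continuous_minus (V := R_NormedModule) (fun z : C => fst c * fst z) (fun z : C => snd c * snd z));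
      apply (continuous_scal_r (V := R_NormedModule)); [apply continuous_fst|apply continuous_snd].
  - apply (continuous_plus (V := R_NormedModule) (fun z : C => fst c * snd z) (fun z : C => snd c * fst z));
      apply (continuous_scal_r (V := R_NormedModule)); [apply continuous_snd|apply continuous_fst].
Qed.

Lemma continuous_on_translated (h : R -> R) (k l theta : R) (u : R * R -> C) :
  continuous_on (closed_domain_above (surface h)) u ->
  continuous_on (closed_domain_above (shifted_surface l h)) (translated_field k l theta u).
Proof.
  intros Hu. unfold translated_field.
  apply (continuous_on_postcomp (U := C_UniformSpace) (V := C_UniformSpace) _
    (fun y => u (translate1 (- l) y)) (fun z => (expi (k * l * sin theta) * z)%C)).
  { intros z. apply continuous_Cmult_const. }
  apply (continuous_on_comp (U := prod_UniformSpace R_UniformSpace R_UniformSpace)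
    _ _ u (translate1 (- l))) with (3 := Hu).
  - intros y _. apply continuous_pair; [|apply continuous_snd].
    apply (continuous_plus (V := R_NormedModule)); [apply continuous_fst|apply continuous_const].
  - intros y Hy. apply closed_domain_above_shifted, Hy.
Qed.

Lemma helmholtz_translated (h : R -> R) (k l theta : R) (u : R * R -> C) :
  C2_line h -> C2_on (domain_above (surface h)) u ->
  (forall x, domain_above (surface h) x -> (laplacian u x + k ^ 2 * u x)%C = 0) ->
  forall y, domain_above (shifted_surface l h) y ->
    (laplacian (translated_field k l theta u) y + k ^ 2 * translated_field k l theta u y)%C = 0.
Proof.
  intros Hh Hu Hhelm [x y] Hxy. apply domain_above_shifted in Hxy.
  specialize (Hhelm _ Hxy). apply domain_above_surface in Hxy.
  unfold translate1 in Hhelm, Hxy. cbn [fst snd] in *.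
  assert (HD : forall x y, h x < y -> locally_2d (fun x y => h x < y) x y).
  { intros a b. apply epigraph_open, Hh. }
  assert (HRe : forall a b, h a < b -> ex_diff_n (fun s t => Re (u (s, t))) 2 a b).
  { intros a b Hab. apply (Hu (a, b)), domain_above_surface, Hab. }
  assert (HIm : forall a b, h a < b -> ex_diff_n (fun s t => Im (u (s, t))) 2 a b).
  { intros a b Hab. apply (Hu (a, b)), domain_above_surface, Hab. }
  apply (ex_diff_2_second_partials (fun x y => h x < y)) in HRe.
  apply (ex_diff_2_second_partials (fun x y => h x < y)) in HIm.
  pose proof (Re_helmholtz k u _ _ Hhelm) as ERe. pose proof (Im_helmholtz k u _ _ Hhelm) as EIm.
  set (c := expi (k * l * sin theta)).
  assert (HDt : forall x y, h (x + - l) < y -> locally_2d (fun x y => h (x + - l) < y) x y).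
  { intros a b Hab. destruct (HD _ _ Hab) as [e He]. exists e. intros s t Hs Ht.
    apply He; [|exact Ht]. replace (s + - l - (a + - l)) with (s - a) by ring. exact Hs. }
  (* Both parts of the translated field are real combinations of [Re u] and [Im u]: [(p, q)] is
     [(fst c, - snd c)] for the real part and [(snd c, fst c)] for the imaginary part. *)
  assert (Hcomb : forall p q : R,
    let f := fun s t => p * Re (u (s + - l, t)) + q * Im (u (s + - l, t)) in
    d1 (d1 f) x y + d2 (d2 f) x y = - k ^ 2 * f x y).
  { intros p q f.
    pose proof (second_partials_translate _ (- l) _ _ _ _ _
      (second_partials_lin _ p q _ _ _ _ _ _ _ _ _ _ HRe HIm)) as Hsp.
    destruct (second_partials_Derive _ _ _ _ _ _ x y HDt Hsp Hxy) as [E1 E2].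
    cbv beta in E1, E2. unfold f. rewrite E1, E2.
    transitivity (p * (- k ^ 2 * Re (u (x + - l, y))) + q * (- k ^ 2 * Im (u (x + - l, y)))); [|ring].
    rewrite <- ERe, <- EIm. ring. }
  rewrite <- RtoC_pow. apply injective_projections.
  - pose proof (Hcomb (fst c) (- snd c)) as H. cbv zeta in H.
    assert (Hext : forall z, Re (translated_field k l theta u z)
      = fst c * Re (u (fst z + - l, snd z)) + - snd c * Im (u (fst z + - l, snd z))).
    { intros z. unfold translated_field. fold c. unfold Re, Im, translate1. simpl. ring. }
    assert (Hlap : Re (laplacian (translated_field k l theta u) (x, y)) = - k ^ 2 * Re (translated_field k l theta u (x, y))).
    { rewrite Hext. cbn [fst snd]. rewrite <- H. unfold laplacian. cbn. f_equal.
      - apply Derive_ext. intros s. apply Derive_ext. intros s'. apply (Hext (s', y)).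
      - apply Derive_ext. intros s. apply Derive_ext. intros s'. apply (Hext (x, s')). }
    unfold Re in Hlap. cbn [fst RtoC Cplus Cmult]. rewrite Hlap. cbn. ring.
  - pose proof (Hcomb (snd c) (fst c)) as H. cbv zeta in H.
    assert (Hext : forall z, Im (translated_field k l theta u z)
      = snd c * Re (u (fst z + - l, snd z)) + fst c * Im (u (fst z + - l, snd z))).
    { intros z. unfold translated_field. fold c. unfold Re, Im, translate1. simpl. ring. }
    assert (Hlap : Im (laplacian (translated_field k l theta u) (x, y)) = - k ^ 2 * Im (translated_field k l theta u (x, y))).
    { rewrite Hext. cbn [fst snd]. rewrite <- H. unfold laplacian. cbn. f_equal.
      - apply Derive_ext. intros s. apply Derive_ext. intros s'. apply (Hext (s', y)).
      - apply Derive_ext. intros s. apply Derive_ext. intros s'. apply (Hext (x, s')). }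
    unfold Im in Hlap. cbn [snd RtoC Cplus Cmult]. rewrite Hlap. cbn. ring.
Qed.

Lemma radiation_translated (h : R -> R) (R0 k l theta : R) (us uinf : R * R -> C) :
  C2_line h -> flat_outside h R0 ->
  solves_scattering_problem (surface h) k theta us ->
  is_far_field k us uinf ->
  radiation_condition k (domain_above (shifted_surface l h)) (translated_field k l theta us).
Proof.
  intros Hh Hflat [HC2 [Hcont [Hhelm [Hbc Hrad]]]] Hff.
  assert (Hzero : forall x, R0 <= enorm (x, 0) -> us (x, 0) = 0).
  { intros x Hx. rewrite Hbc by (apply (proj2 Hflat (x, 0) Hx); reflexivity).
    unfold incident_wave, reflected_wave.
    replace (k * vdot (sin theta, cos theta) (x, 0)) with (k * vdot (sin theta, - cos theta) (x, 0))
      by (unfold vdot; simpl; ring). ring. }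
  destruct (scattered_field_bounded h R0 k us uinf Hflat Hcont Hff Hzero) as [M [R1 [HM [HR1 HMb]]]].
  assert (Hflat1 : flat_outside h R1).
  { split; [destruct Hflat; lra|]. intros x Hx. apply Hflat. lra. }
  set (uR := fun s t => Re (us (s, t))). set (uI := fun s t => Im (us (s, t))).
  assert (HRe : forall a b, h a < b -> ex_diff_n uR 2 a b).
  { intros a b Hab. apply (HC2 (a, b)), domain_above_surface, Hab. }
  assert (HIm : forall a b, h a < b -> ex_diff_n uI 2 a b).
  { intros a b Hab. apply (HC2 (a, b)), domain_above_surface, Hab. }
  destruct (far_gradient_bound h R1 M k uR) as [GR [HGR HR]]; auto.
  { apply continuous_on_ext with (2 := continuous_on_Re _ _ Hcont). intros [a b] _. reflexivity. }
  { intros x y Hxy. apply (Re_helmholtz k us), Hhelm, domain_above_surface, Hxy. }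
  { intros x y H1 H2. apply Rle_trans with (2 := HMb (x, y) H1 H2). apply re_le_Cmod. }
  { intros x Hx. unfold uR. rewrite Hzero by lra. reflexivity. }
  destruct (far_gradient_bound h R1 M k uI) as [GI [HGI HI]]; auto.
  { apply continuous_on_ext with (2 := continuous_on_Im _ _ Hcont). intros [a b] _. reflexivity. }
  { intros x y Hxy. apply (Im_helmholtz k us), Hhelm, domain_above_surface, Hxy. }
  { intros x y H1 H2. apply Rle_trans with (2 := HMb (x, y) H1 H2).
    apply Rle_trans with (2 := Rmax_Cmod (us (x, y))), Rmax_r. }
  { intros x Hx. unfold uI. rewrite Hzero by lra. reflexivity. }
  set (G := GR + GI).
  intros eps Heps.
  (* Passing from [sqrt |x|] to [sqrt |y|] costs a factor of at most 2, so this error uses up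
     [eps / 2]; the other half is kept for the turned direction. *)
  destruct (Hrad (eps / 4)) as [R2 HR2]; [lra|].
  pose proof (Rabs_pos l) as Hl. pose proof (Rabs_pos R2) as HR2pos.
  (* Chosen so that [3 * G * Rabs l < eps / 2 * Q]. The term [Q ^ 2] in the radius gives
     [Q < sqrt |y|], and [2 * Rabs l] gives [|x| >= |y| / 2]. *)
  set (Q := 6 * G * Rabs l / eps + 1).
  assert (HQ : 1 <= Q).
  { assert (0 <= 6 * G * Rabs l / eps); [|unfold Q; lra].
    apply Rmult_le_pos; [|apply Rlt_le, Rinv_0_lt_compat, Heps].
    repeat apply Rmult_le_pos; unfold G; lra. }
  exists (R1 + Rabs R2 + 2 + 2 * Rabs l + Q ^ 2). intros y Hy Hyfar.
  set (x := translate1 (- l) y).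
  assert (Hyx : y = translate1 l x).
  { unfold x, translate1. destruct y. simpl. f_equal. ring. }
  pose proof (proj1 Hflat1) as HR1pos.
  pose proof (enorm_translate1_le l x) as Hd. rewrite <- Hyx in Hd. apply Rabs_le_between in Hd.
  assert (HQ2 : 1 <= Q ^ 2) by nra.
  assert (Hx0 : 0 < enorm x) by lra. assert (Hy0 : 0 < enorm y) by lra.
  apply domain_above_shifted in Hy. fold x in Hy.
  pose proof (proj1 (domain_above_surface h x) Hy) as Hhx.
  assert (Hx2 : 0 < snd x) by (apply (proj2 Hflat1 x); lra).
  pose proof (Rle_abs R2) as HR2abs.
  specialize (HR2 x Hy ltac:(lra)).
  assert (HD : forall x y, h x < y -> locally_2d (fun x y => h x < y) x y).
  { intros a b. apply epigraph_open, Hh. }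
  pose proof (ex_diff_2_differentiable _ uR (fst x) (snd x) HD HRe Hhx) as DR.
  pose proof (ex_diff_2_differentiable _ uI (fst x) (snd x) HD HIm Hhx) as DI.
  destruct (HR (fst x) (snd x)) as [B1 B2]; [destruct x; simpl in *; lra|exact Hx2|].
  destruct (HI (fst x) (snd x)) as [B3 B4]; [destruct x; simpl in *; lra|exact Hx2|].
  set (a1 := d1 uR (fst x) (snd x)) in *. set (a2 := d2 uR (fst x) (snd x)) in *.
  set (b1 := d1 uI (fst x) (snd x)) in *. set (b2 := d2 uI (fst x) (snd x)) in *.
  set (E := expi (k * l * sin theta)).
  assert (Hrx : radial_derivative us x
    = (a1 * fst (unit_vec x) + a2 * snd (unit_vec x), b1 * fst (unit_vec x) + b2 * snd (unit_vec x))%R).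
  { rewrite <- (Cmult_1_l (_, _)). unfold radial_derivative.
    apply (DeriveC_along_ray _ (fun s t => us (s, t)) 1 0 0).
    - intros s. rewrite Cmult_1_l, !Rplus_0_l. reflexivity.
    - replace (0 + enorm x * fst (unit_vec x)) with (fst x) by (unfold unit_vec, vscale; simpl; field; lra).
      replace (0 + enorm x * snd (unit_vec x)) with (snd x) by (unfold unit_vec, vscale; simpl; field; lra).
      exact DR.
    - replace (0 + enorm x * fst (unit_vec x)) with (fst x) by (unfold unit_vec, vscale; simpl; field; lra).
      replace (0 + enorm x * snd (unit_vec x)) with (snd x) by (unfold unit_vec, vscale; simpl; field; lra).
      exact DI. }
  assert (Hry : radial_derivative (translated_field k l theta us) y
    = (E * (a1 * fst (unit_vec y) + a2 * snd (unit_vec y), b1 * fst (unit_vec y) + b2 * snd (unit_vec y))%R)%C).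
  { unfold radial_derivative.
    assert (F1 : - l + enorm y * fst (unit_vec y) = fst x).
    { unfold unit_vec, vscale, x, translate1. simpl. field. lra. }
    assert (F2 : 0 + enorm y * snd (unit_vec y) = snd x).
    { unfold unit_vec, vscale, x, translate1. simpl. field. lra. }
    apply (DeriveC_along_ray _ (fun s t => us (s, t)) E (- l) 0).
    - intros s. unfold translated_field, translate1, vscale. cbn [fst snd]. fold E.
      rewrite (Rplus_comm _ (- l)), Rplus_0_l. reflexivity.
    - rewrite F1, F2. exact DR.
    - rewrite F1, F2. exact DI. }
  set (e1 := fst (unit_vec y) - fst (unit_vec x)). set (e2 := snd (unit_vec y) - snd (unit_vec x)).
  destruct (unit_vec_translate1 l x y Hyx Hx0 Hy0) as [He1 He2]. fold e1 in He1. fold e2 in He2.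
  (* The whole discrepancy: the gradient of [us] at [x] applied to the difference of the two radial
     directions. The terms [Ci * k * u] match exactly. *)
  set (delta := (a1 * e1 + a2 * e2, b1 * e1 + b2 * e2)%R : C).
  set (A := (radial_derivative us x - Ci * k * us x)%C) in *.
  replace (sqrt (enorm y) * (radial_derivative (translated_field k l theta us) y
      - Ci * k * translated_field k l theta us y))%C
    with (sqrt (enorm y) * (E * (A + delta)))%C.
  2:{ rewrite Hry. unfold translated_field. fold x E. unfold A. rewrite Hrx.
      apply f_equal. transitivity (E * ((radial_derivative us x + delta) - Ci * k * us x))%C;
        [rewrite Hrx; ring|].
      rewrite Hrx. unfold delta, e1, e2.
      match goal with |- (E * (?P - _))%C = (E * ?P' - _)%C => replace P with P' end; [ring|].
      apply injective_projections; simpl; ring. }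
  rewrite !Cmod_mult, Cmod_R in *. unfold E. rewrite Cmod_expi, Rmult_1_l.
  assert (Hsx : 0 < sqrt (enorm x)) by (apply sqrt_lt_R0, Hx0).
  assert (Hsy : 0 < sqrt (enorm y)) by (apply sqrt_lt_R0, Hy0).
  rewrite Rabs_right in HR2 by lra. rewrite Rabs_right by lra.
  assert (Hsxy : sqrt (enorm y) <= 2 * sqrt (enorm x)).
  { apply Rsqr_incr_0; [|lra|lra]. unfold Rsqr.
    replace (2 * sqrt (enorm x) * (2 * sqrt (enorm x))) with (4 * (sqrt (enorm x) * sqrt (enorm x))) by ring.
    rewrite !sqrt_sqrt by lra. lra. }
  assert (HsQ : Q < sqrt (enorm y)).
  { rewrite <- (sqrt_pow2 Q) by lra. apply sqrt_lt_1_alt. lra. }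
  assert (Hdelta : Cmod delta <= 3 * G * Rabs l / enorm y).
  { eapply Rle_trans; [apply Cmod_le_abs|]. unfold delta. cbn [fst snd].
    assert (Hab : forall g b b', Rabs b <= g -> Rabs b' <= g ->
      Rabs (b * e1 + b' * e2) <= g * (2 * Rabs l / enorm y) + g * (Rabs l / enorm y)).
    { intros g b b' Hb Hb'. eapply Rle_trans; [apply Rabs_triang|]. rewrite !Rabs_mult.
      apply Rplus_le_compat; apply Rmult_le_compat; auto using Rabs_pos. }
    pose proof (Hab GR a1 a2 B1 B2). pose proof (Hab GI b1 b2 B3 B4).
    replace (3 * G * Rabs l / enorm y) with
      ((GR * (2 * Rabs l / enorm y) + GR * (Rabs l / enorm y)) +
       (GI * (2 * Rabs l / enorm y) + GI * (Rabs l / enorm y))) by (unfold G; field; lra).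
    lra. }
  assert (Hs1 : sqrt (enorm y) * Cmod A < eps / 2).
  { apply Rle_lt_trans with (2 * sqrt (enorm x) * Cmod A); [|lra].
    apply Rmult_le_compat_r; [apply Cmod_ge_0|exact Hsxy]. }
  assert (Hs2 : sqrt (enorm y) * Cmod delta < eps / 2).
  { apply Rle_lt_trans with (sqrt (enorm y) * (3 * G * Rabs l / enorm y)).
    { apply Rmult_le_compat_l; lra. }
    replace (sqrt (enorm y) * (3 * G * Rabs l / enorm y)) with (3 * G * Rabs l / sqrt (enorm y)).
    2:{ replace (3 * G * Rabs l / enorm y) with (3 * G * Rabs l / (sqrt (enorm y) * sqrt (enorm y)))
          by (rewrite sqrt_sqrt by lra; reflexivity).
        field. lra. }
    apply Rmult_lt_reg_r with (sqrt (enorm y)); [exact Hsy|].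
    unfold Rdiv at 1. rewrite Rmult_assoc, Rinv_l by lra.
    apply Rlt_le_trans with (eps / 2 * Q); [|apply Rmult_le_compat_l; lra].
    replace (eps / 2 * Q) with (3 * G * Rabs l + eps / 2) by (unfold Q; field; lra). lra. }
  apply Rle_lt_trans with (sqrt (enorm y) * (Cmod A + Cmod delta)).
  - apply Rmult_le_compat_l; [lra|apply Cmod_triangle].
  - lra.
Qed.

(** The far-field expansion enters through the radiation condition, where it supplies the bound on
    [us] at infinity. *)
Lemma scattering_solution_translated (h : R -> R) (k l theta : R) (us uinf : R * R -> C) :
  C2_line h -> compact_support h ->
  solves_scattering_problem (surface h) k theta us ->
  is_far_field k us uinf ->
  solves_scattering_problem (shifted_surface l h) k theta (translated_field k l theta us).
Proof.
  intros Hh Hsupp Hus Hff. destruct (surface_flat_at_infinity h Hh Hsupp) as [R0 Hflat].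
  pose proof (radiation_translated h R0 k l theta us uinf Hh Hflat Hus Hff) as Hrad.
  destruct Hus as [HC2 [Hcont [Hhelm [Hbc _]]]].
  split; [|split; [|split; [|split]]].
  - apply C2_on_translated; assumption.
  - apply continuous_on_translated, Hcont.
  - apply (helmholtz_translated h); assumption.
  - intros y Hy. apply shifted_surface_translate in Hy.
    unfold translated_field. rewrite (Hbc _ Hy).
    assert (Hyx : y = translate1 l (translate1 (- l) y)).
    { unfold translate1. destruct y. simpl. f_equal. ring. }
    pose proof (incident_wave_translate1 k l theta (translate1 (- l) y)) as Hi.
    pose proof (reflected_wave_translate1 k l theta (translate1 (- l) y)) as Hr.
    rewrite <- Hyx in Hi, Hr. rewrite Hi, Hr. ring.
  - exact Hrad.
Qed.

(** * Far-field patterns *)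

(* [uinf] is continuous as a locally uniform limit of the rescaled restrictions
   of [us] to large circles. *)
Lemma far_field_continuous (h : R -> R) (R0 k : R) (us uinf : R * R -> C) (e : R * R) (eps : R) :
  flat_outside h R0 ->
  continuous_on (closed_domain_above (surface h)) us ->
  is_far_field k us uinf ->
  upper_circle e -> 0 < eps ->
  exists delta, 0 < delta /\ forall e', upper_circle e' ->
    Rabs (fst e' - fst e) < delta -> Rabs (snd e' - snd e) < delta ->
    Cmod (uinf e' - uinf e) < eps.
Proof.
  intros Hflat Hc [w [C0 [Rf [HRf Hfar]]]] He Heps.
  pose proof (proj1 Hflat) as HR0. pose proof (Rabs_pos C0) as HC0.
  (* The last summand makes the remainder on this circle at most [eps / 4]. *)
  set (r := R0 + Rf + 1 + 4 * Rabs C0 / eps).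
  assert (Hq : 0 <= 4 * Rabs C0 / eps).
  { apply Rmult_le_pos; [lra|apply Rlt_le, Rinv_0_lt_compat, Heps]. }
  assert (Hr : 0 < r) by (unfold r; lra).
  assert (Hsr : 0 < sqrt r) by (apply sqrt_lt_R0, Hr).
  assert (Hexp : forall e', upper_circle e' -> exists w',
    us (vscale r e') = (expi (k * r) / sqrt r * (uinf e' + w'))%C /\ Cmod w' <= eps / 4).
  { intros e' [H1 H2].
    assert (Hn : enorm (vscale r e') = r) by (rewrite enorm_vscale, H1; lra).
    destruct (Hfar (vscale r e')) as [E1 E2].
    - rewrite Hn. unfold r. lra.
    - rewrite unit_vec_vscale by assumption. split; assumption.
    - rewrite Hn, unit_vec_vscale in E1 by assumption. rewrite Hn in E2.
      exists (w (vscale r e')). split; [exact E1|].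
      apply Rle_trans with (1 := E2). apply Rle_trans with (Rabs C0 / r).
      + apply Rmult_le_compat_r; [apply Rlt_le, Rinv_0_lt_compat, Hr|apply Rle_abs].
      + apply Rmult_le_reg_r with r; [exact Hr|]. unfold Rdiv at 1.
        rewrite Rmult_assoc, Rinv_l by lra.
        replace (eps / 4 * r) with (eps / 4 * (R0 + Rf + 1) + Rabs C0) by (unfold r; field; lra).
        assert (0 <= eps / 4 * (R0 + Rf + 1)) by (apply Rmult_le_pos; lra). lra. }
  assert (Hdom : closed_domain_above (surface h) (vscale r e)).
  { apply closed_domain_above_surface, (flat_outside_le h R0); [exact Hflat| |].
    - rewrite enorm_vscale, (proj1 He) by lra. unfold r. lra.
    - apply Rmult_le_pos; [lra|]. destruct He. lra. }
  assert (Hdom' : forall e', upper_circle e' -> closed_domain_above (surface h) (vscale r e')).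
  { intros e' He'. apply closed_domain_above_surface, (flat_outside_le h R0); [exact Hflat| |].
    - rewrite enorm_vscale, (proj1 He') by lra. unfold r. lra.
    - apply Rmult_le_pos; [lra|]. destruct He'. lra. }
  (* Real and imaginary part together give [eps / (4 * sqrt r)], and undoing the decay factor
     [/ sqrt r] leaves [eps / 4]. *)
  assert (Htol : 0 < eps / (8 * sqrt r)).
  { apply Rmult_lt_0_compat; [lra|apply Rinv_0_lt_compat; lra]. }
  destruct (Hc _ Hdom (ball (M := C_UniformSpace) (us (vscale r e)) (mkposreal _ Htol)) (locally_ball _ _))
    as [d Hd].
  exists (d / r). split; [apply Rmult_lt_0_compat; [apply cond_pos|apply Rinv_0_lt_compat, Hr]|].
  intros e' He' H1 H2.
  assert (Hsc : forall a b, Rabs (a - b) < d / r -> Rabs (r * a - r * b) < d).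
  { intros a b H. rewrite <- Rmult_minus_distr_l, Rabs_mult, (Rabs_right r) by lra.
    replace (pos d) with (r * (d / r)) by (field; lra). apply Rmult_lt_compat_l; assumption. }
  destruct (Hd (vscale r e')) as [B1 B2].
  { split; unfold vscale; cbn [fst snd]; apply Hsc; assumption. }
  { apply Hdom', He'. }
  destruct (Hexp e He) as [w1 [E1 W1]]. destruct (Hexp e' He') as [w2 [E2 W2]].
  assert (Hus : Cmod (us (vscale r e') - us (vscale r e)) < eps / (4 * sqrt r)).
  { eapply Rle_lt_trans; [apply Cmod_le_abs|].
    replace (eps / (4 * sqrt r)) with (eps / (8 * sqrt r) + eps / (8 * sqrt r)) by (field; lra).
    apply Rplus_lt_compat; [exact B1|exact B2]. }
  assert (Hdiff : Cmod ((uinf e' + w2) - (uinf e + w1)) < eps / 4).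
  { replace (us (vscale r e') - us (vscale r e))%C
      with (expi (k * r) / sqrt r * ((uinf e' + w2) - (uinf e + w1)))%C in Hus
      by (rewrite E1, E2; ring).
    rewrite Cmod_far_factor in Hus by exact Hr.
    apply Rmult_lt_reg_l with (/ sqrt r); [apply Rinv_0_lt_compat, Hsr|].
    replace (/ sqrt r * (eps / 4)) with (eps / (4 * sqrt r)) by (field; lra). exact Hus. }
  replace (uinf e' - uinf e)%C with (((uinf e' + w2) - (uinf e + w1)) + (w1 - w2))%C by ring.
  eapply Rle_lt_trans; [apply Cmod_triangle|].
  assert (Cmod (w1 - w2) <= Cmod w1 + Cmod w2).
  { rewrite <- (Cmod_opp w2). apply Cmod_triangle. }
  lra.
Qed.

Lemma Rabs_sin_le (t : R) : Rabs (sin t) <= Rabs t.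
Proof.
  destruct (MVT_abs sin cos 0 t) as [c [Hc _]].
  - intros c _. apply derivable_pt_lim_sin.
  - rewrite sin_0, !Rminus_0_r in Hc. rewrite Hc.
    rewrite <- (Rmult_1_l (Rabs t)) at 2. apply Rmult_le_compat_r; [apply Rabs_pos|].
    apply Rabs_le, COS_bound.
Qed.

Lemma Rabs_cos_minus_1_le (t : R) : Rabs (cos t - 1) <= Rabs t.
Proof.
  destruct (MVT_abs cos (fun x => - sin x) 0 t) as [c [Hc _]].
  - intros c _. apply derivable_pt_lim_cos.
  - rewrite cos_0, Rminus_0_r in Hc. rewrite Hc.
    rewrite <- (Rmult_1_l (Rabs t)) at 2. apply Rmult_le_compat_r; [apply Rabs_pos|].
    rewrite Rabs_Ropp. apply Rabs_le, SIN_bound.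
Qed.

Lemma Cmod_expi_minus_1_le (t : R) : Cmod (expi t - 1) <= 2 * Rabs t.
Proof.
  eapply Rle_trans; [apply Cmod_le_abs|]. simpl.
  replace (sin t + - 0) with (sin t) by ring.
  pose proof (Rabs_sin_le t). pose proof (Rabs_cos_minus_1_le t). unfold Rminus in *. lra.
Qed.

Lemma Rabs_sqrt_minus_1_le (z : R) : 0 <= z -> Rabs (sqrt z - 1) <= Rabs (z - 1).
Proof.
  intros Hz. pose proof (sqrt_pos z) as Hs.
  replace (z - 1) with ((sqrt z - 1) * (sqrt z + 1)).
  2:{ rewrite <- (sqrt_sqrt z) at 3 by exact Hz. ring. }
  rewrite Rabs_mult, (Rabs_right (sqrt z + 1)) by lra.
  rewrite <- (Rmult_1_r (Rabs (sqrt z - 1))) at 1.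
  apply Rmult_le_compat_l; [apply Rabs_pos|lra].
Qed.

(** With [x] the translated point, [|x|^2 - r^2] is explicit, and multiplying the left side by
    [|x| + r] leaves [l^2 + l e1 (|x| - r)]. This is at most [2 l^2] because [|x|] and [r] differ by
    at most [|l|]; no expansion of the square root is needed. *)
Lemma enorm_translate1_ray (l r : R) (e : R * R) :
  enorm e = 1 -> 0 < r ->
  Rabs (enorm (translate1 (- l) (vscale r e)) - r + l * fst e) <= 2 * l ^ 2 / r.
Proof.
  intros He Hr. set (x := translate1 (- l) (vscale r e)).
  pose proof (enorm_translate1_le (- l) (vscale r e)) as Hd. fold x in Hd.
  rewrite enorm_vscale, He, Rmult_1_r, Rabs_Ropp in Hd by lra.
  pose proof (enorm_ge_0 x) as Hx.
  assert (Hsq : (enorm x - r) * (enorm x + r) = - 2 * r * l * fst e + l ^ 2).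
  { replace ((enorm x - r) * (enorm x + r)) with (enorm x * enorm x - r ^ 2 * 1) by ring.
    replace 1 with (enorm e * enorm e) by (rewrite He; ring). rewrite !enorm_sqr.
    unfold x, translate1, vscale. cbn [fst snd]. ring. }
  assert (Hfst : Rabs (fst e) <= 1) by (rewrite <- He; apply enorm_fst_le).
  apply Rmult_le_reg_r with (enorm x + r); [lra|].
  rewrite <- (Rabs_right (enorm x + r)) at 1 by lra. rewrite <- Rabs_mult.
  replace ((enorm x - r + l * fst e) * (enorm x + r)) with (l * l + l * (fst e * (enorm x - r)))
    by (rewrite Rmult_plus_distr_r, Hsq; ring).
  assert (H1 : Rabs (l * l + l * (fst e * (enorm x - r))) <= 2 * l ^ 2).
  { eapply Rle_trans; [apply Rabs_triang|]. rewrite !Rabs_mult.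
    assert (Hl2 : Rabs l * Rabs l = l ^ 2) by (rewrite <- pow2_abs; ring).
    assert (Rabs l * (Rabs (fst e) * Rabs (enorm x - r)) <= Rabs l * (1 * Rabs l)).
    { apply Rmult_le_compat_l; [apply Rabs_pos|]. apply Rmult_le_compat; auto using Rabs_pos. }
    lra. }
  apply Rle_trans with (1 := H1).
  assert (0 <= 2 * l ^ 2 / r * enorm x).
  { apply Rmult_le_pos; [|exact Hx]. apply Rmult_le_pos; [|apply Rlt_le, Rinv_0_lt_compat, Hr].
    pose proof (pow2_ge_0 l). lra. }
  replace (2 * l ^ 2 / r * (enorm x + r)) with (2 * l ^ 2 / r * enorm x + 2 * l ^ 2) by (field; lra).
  lra.
Qed.

(** The limit is replaced by a single radius: if the two sides differed by [eta > 0], a point at a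
    suitable distance [r] would give [eta <= K / r + eta / 4 <= eta / 2]. *)
Lemma far_field_translated (h : R -> R) (R0 l k theta : R) (us usl uinf uinfl : R * R -> C) (e : R * R) :
  flat_outside h R0 ->
  continuous_on (closed_domain_above (surface h)) us ->
  is_far_field k us uinf -> is_far_field k usl uinfl ->
  (forall x, domain_above (surface h) x ->
     usl (translate1 l x) = (expi (k * l * sin theta) * us x)%C) ->
  upper_circle e ->
  uinfl e = (expi (k * l * (sin theta - fst e)) * uinf e)%C.
Proof.
  intros Hflat Hc Hff Hffl Htr He.
  set (P := expi (k * l * (sin theta - fst e))).
  destruct (Ceq_dec (uinfl e - P * uinf e) 0) as [Heq|Hne].
  { replace (uinfl e) with ((uinfl e - P * uinf e) + P * uinf e)%C by ring. rewrite Heq. ring. }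
  exfalso. set (eta := Cmod (uinfl e - P * uinf e)).
  assert (Heta : 0 < eta) by (apply Cmod_gt_0, Hne).
  destruct (far_field_continuous h R0 k us uinf e (eta / 8) Hflat Hc Hff He) as [dl [Hdl Hcont]]; [lra|].
  destruct Hff as [w [C0 [Rf [HRf Hfar]]]]. destruct Hffl as [wl [C1 [Rl [HRl Hfarl]]]].
  pose proof (proj1 Hflat) as HR0. pose proof (Rabs_pos l) as Hl.
  pose proof (Rabs_pos C0) as HC0. pose proof (Rabs_pos C1) as HC1.
  pose proof (Rabs_pos k) as Hk. pose proof (pow2_ge_0 l) as Hl2.
  pose proof (Cmod_ge_0 (uinf e)) as Hu0.
  (* In order, the contributions of the remainder at [y], of the remainder at [x] (with
     [Cmod q <= 2] and [/ rho <= 2 / r]), and of the deviation of [q] from 1. *)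
  set (K := Rabs C1 + 4 * Rabs C0 + (2 * Rabs l + 4 * (Rabs k * l ^ 2)) * Cmod (uinf e)).
  assert (Hkl : 0 <= Rabs k * l ^ 2) by (apply Rmult_le_pos; lra).
  assert (HK : 0 <= K).
  { unfold K. apply Rplus_le_le_0_compat; [lra|apply Rmult_le_pos; lra]. }
  assert (HKe : 0 <= 4 * K / eta).
  { apply Rmult_le_pos; [lra|apply Rlt_le, Rinv_0_lt_compat, Heta]. }
  assert (Hld : 0 <= 4 * Rabs l / dl).
  { apply Rmult_le_pos; [lra|apply Rlt_le, Rinv_0_lt_compat, Hdl]. }
  (* The first summand puts [x] and [y] beyond all radii with [rho >= r / 2], the second gives
     [K / r <= eta / 4], and the third brings the direction of [x] within [dl] of [e]. *)
  set (r := 2 * (R0 + Rf + Rl + 1 + 2 * Rabs l) + 4 * K / eta + 4 * Rabs l / dl).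
  assert (Hr : 0 < r) by (unfold r; lra).
  set (y := vscale r e). set (x := translate1 (- l) y).
  assert (Hny : enorm y = r) by (unfold y; rewrite enorm_vscale, (proj1 He); lra).
  assert (Huy : unit_vec y = e) by (unfold y; apply unit_vec_vscale; [exact Hr|apply He]).
  assert (Hyx : y = translate1 l x).
  { unfold x, translate1. destruct y. simpl. f_equal. ring. }
  pose proof (enorm_translate1_le l x) as Hd. rewrite <- Hyx, Hny in Hd.
  pose proof (proj1 (Rabs_le_between _ _) Hd) as Hd'.
  set (rho := enorm x) in *.
  assert (Hrho : r / 2 <= rho /\ Rf < rho /\ R0 <= rho) by (unfold r in *; lra).
  assert (Hx2 : 0 < snd x).
  { unfold x, y, translate1, vscale. simpl. apply Rmult_lt_0_compat; [exact Hr|apply He]. }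
  pose proof (upper_circle_unit_vec x Hx2) as Hux.
  assert (Hdx : domain_above (surface h) x).
  { apply domain_above_surface, (proj2 Hflat x); [apply Hrho|exact Hx2]. }
  specialize (Htr x Hdx). rewrite <- Hyx in Htr.
  destruct (Hfar x) as [Ex Wx]; [apply Hrho|exact Hux|].
  destruct (Hfarl y) as [Ey Wy]; [rewrite Hny; unfold r; lra|rewrite Huy; exact He|].
  rewrite Huy, Hny in Ey. rewrite Hny in Wy. fold rho in Ex, Wx.
  (* [t] is the phase left over after [P] is split off, and [s] is the ratio of the two amplitude
     factors; [q = s * expi t] is within [O(1 / r)] of 1. *)
  set (t := k * (rho - r + l * fst e)). set (s := sqrt (r / rho)).
  assert (Hsr : 0 < sqrt r) by (apply sqrt_lt_R0, Hr).
  assert (Hsrho : 0 < sqrt rho) by (apply sqrt_lt_R0; lra).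
  assert (Hs : s = sqrt r / sqrt rho) by (apply sqrt_div; lra).
  assert (Hmain : (uinfl e + wl y = P * (s * expi t * (uinf (unit_vec x) + w x)))%C).
  (* Cancelling the far-field prefactor at [y] makes [us] reappear, so that the transformation law
     and the expansion at [x] can be inserted. *)
  { assert (Hinv : forall z : C, z = (sqrt r * expi (- (k * r)) * (expi (k * r) / sqrt r * z))%C).
    { intros z. transitivity (expi (- (k * r) + k * r) * z)%C.
      - replace (- (k * r) + k * r) with 0 by ring. unfold expi. rewrite cos_0, sin_0.
        apply injective_projections; simpl; ring.
      - rewrite expi_add. field. intros H. apply RtoC_inj in H. lra. }
    rewrite (Hinv (uinfl e + wl y)%C), <- Ey, Htr, Ex.
    transitivity (s * expi (- (k * r) + (k * l * sin theta + k * rho)) * (uinf (unit_vec x) + w x))%C.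
    - rewrite Hs, RtoC_div, !expi_add by lra. field. intros H. apply RtoC_inj in H. lra.
    - replace (- (k * r) + (k * l * sin theta + k * rho))
        with (k * l * (sin theta - fst e) + t) by (unfold t; ring).
      rewrite expi_add. fold P. ring. }
  set (q := (s * expi t)%C) in *.
  assert (Hs0 : 0 <= s) by apply sqrt_pos.
  assert (Hrr : 0 <= r / rho <= 2).
  { split; [apply Rmult_le_pos; [lra|apply Rlt_le, Rinv_0_lt_compat; lra]|].
    apply Rmult_le_reg_r with rho; [lra|]. unfold Rdiv. rewrite Rmult_assoc, Rinv_l by lra. lra. }
  assert (Hs2 : s <= 2).
  { unfold s. rewrite <- (sqrt_pow2 2) by lra. apply sqrt_le_1_alt. lra. }
  assert (Hq : Cmod q <= 2).
  { unfold q. rewrite Cmod_mult, Cmod_expi, Cmod_R, Rabs_right; lra. }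
  assert (Hinvr : forall a, 0 <= a -> a / rho <= 2 * a / r).
  { intros a Ha. replace (2 * a / r) with (a * / (r / 2)) by (field; lra).
    apply Rmult_le_compat_l; [exact Ha|]. apply Rinv_le_contravar; lra. }
  assert (Hq1 : Cmod (q - 1) <= (2 * Rabs l + 4 * (Rabs k * l ^ 2)) / r).
  { replace (q - 1)%C with ((s - 1)%R * expi t + (expi t - 1))%C
      by (unfold q; rewrite RtoC_minus; ring).
    eapply Rle_trans; [apply Cmod_triangle|]. rewrite Cmod_mult, Cmod_expi, Cmod_R, Rmult_1_r.
    pose proof (Rabs_sqrt_minus_1_le (r / rho) (proj1 Hrr)) as H1. fold s in H1.
    replace (r / rho - 1) with ((r - rho) / rho) in H1 by (field; lra).
    unfold Rdiv in H1 at 1. rewrite Rabs_mult, Rabs_inv, (Rabs_right rho) in H1 by lra.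
    assert (H2 : Rabs (r - rho) * / rho <= 2 * Rabs l / r).
    { apply Rle_trans with (Rabs l / rho); [|apply Hinvr, Hl].
      apply Rmult_le_compat_r; [apply Rlt_le, Rinv_0_lt_compat; lra|exact Hd]. }
    pose proof (Cmod_expi_minus_1_le t) as H3.
    pose proof (enorm_translate1_ray l r e (proj1 He) Hr) as H4. fold y x rho in H4.
    assert (H5 : Rabs t <= Rabs k * (2 * l ^ 2 / r)).
    { unfold t. rewrite Rabs_mult. apply Rmult_le_compat_l; assumption. }
    replace ((2 * Rabs l + 4 * (Rabs k * l ^ 2)) / r)
      with (2 * Rabs l / r + 2 * (Rabs k * (2 * l ^ 2 / r))) by (field; lra). lra. }
  assert (Hdir : Cmod (uinf (unit_vec x) - uinf e) < eta / 8).
  { destruct (unit_vec_translate1 l x y Hyx) as [D1 D2]; [unfold rho in *; lra|lra|].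
    rewrite Huy, Hny in D1, D2.
    assert (Hsmall : 2 * Rabs l / r < dl).
    { apply Rmult_lt_reg_r with r; [exact Hr|]. unfold Rdiv. rewrite Rmult_assoc, Rinv_l by lra.
      replace (dl * r) with (dl * (2 * (R0 + Rf + Rl + 1 + 2 * Rabs l) + 4 * K / eta) + 4 * Rabs l)
        by (unfold r; field; lra).
      assert (0 < dl * (2 * (R0 + Rf + Rl + 1 + 2 * Rabs l) + 4 * K / eta))
        by (apply Rmult_lt_0_compat; lra). lra. }
    assert (Rabs l / r <= 2 * Rabs l / r).
    { apply Rmult_le_compat_r; [apply Rlt_le, Rinv_0_lt_compat, Hr|lra]. }
    apply Hcont; [exact Hux| |]; rewrite Rabs_minus_sym; lra. }
  assert (Hw : Cmod (w x) <= 2 * Rabs C0 / r).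
  { apply Rle_trans with (1 := Wx). apply Rle_trans with (Rabs C0 / rho); [|apply Hinvr, HC0].
    apply Rmult_le_compat_r; [apply Rlt_le, Rinv_0_lt_compat; lra|apply Rle_abs]. }
  assert (Hwl : Cmod (wl y) <= Rabs C1 / r).
  { apply Rle_trans with (1 := Wy).
    apply Rmult_le_compat_r; [apply Rlt_le, Rinv_0_lt_compat, Hr|apply Rle_abs]. }
  assert (Hbound : eta <= K / r + eta / 4).
  { unfold eta at 1.
    (* Four errors: the change of direction, the remainder at [x], the deviation of [q] from 1, and
       the remainder at [y]. The first is at most [eta / 4], and the others add up to [K / r]. *)
    replace (uinfl e - P * uinf e)%C
      with (P * (q * (uinf (unit_vec x) - uinf e) + (q * w x + (q - 1) * uinf e)) - wl y)%C.
    2:{ replace (uinfl e) with ((uinfl e + wl y) - wl y)%C by ring. rewrite Hmain. ring. }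
    unfold Cminus at 1. eapply Rle_trans; [apply Cmod_triangle|].
    rewrite Cmod_opp, Cmod_mult. unfold P. rewrite Cmod_expi, Rmult_1_l.
    eapply Rle_trans; [apply Rplus_le_compat_r, Cmod_triangle|].
    eapply Rle_trans; [apply Rplus_le_compat_r, Rplus_le_compat_l, Cmod_triangle|].
    rewrite !Cmod_mult.
    assert (T1 : Cmod q * Cmod (uinf (unit_vec x) - uinf e) <= 2 * (eta / 8)).
    { apply Rmult_le_compat; auto using Cmod_ge_0; lra. }
    assert (T2 : Cmod q * Cmod (w x) <= 2 * (2 * Rabs C0 / r)).
    { apply Rmult_le_compat; auto using Cmod_ge_0. }
    assert (T3 : Cmod (q - 1) * Cmod (uinf e)
      <= (2 * Rabs l + 4 * (Rabs k * l ^ 2)) / r * Cmod (uinf e)).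
    { apply Rmult_le_compat_r; assumption. }
    replace (K / r) with (Rabs C1 / r + 2 * (2 * Rabs C0 / r)
      + (2 * Rabs l + 4 * (Rabs k * l ^ 2)) / r * Cmod (uinf e)) by (unfold K; field; lra).
    lra. }
  assert (HKr : K / r <= eta / 4).
  { apply Rmult_le_reg_r with r; [exact Hr|]. unfold Rdiv at 1. rewrite Rmult_assoc, Rinv_l by lra.
    replace (eta / 4 * r)
      with (eta / 4 * (2 * (R0 + Rf + Rl + 1 + 2 * Rabs l) + 4 * Rabs l / dl) + K)
      by (unfold r; field; lra).
    assert (0 <= eta / 4 * (2 * (R0 + Rf + Rl + 1 + 2 * Rabs l) + 4 * Rabs l / dl))
      by (apply Rmult_le_pos; lra). lra. }
  lra.
Qed.

Theorem theorem3p1 (h : R -> R) (l k theta : R)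
    (us usl uinf uinfl : R * R -> C) :
  C2_line h ->
  compact_support h ->
  0 < k ->
  - (PI / 2) < theta < PI / 2 ->
  is_scattering_solution (surface h) k theta us ->
  is_scattering_solution (shifted_surface l h) k theta usl ->
  is_far_field k us uinf ->
  is_far_field k usl uinfl ->
  (forall x, domain_above (surface h) x ->
     usl (translate1 l x) = (expi (k * l * sin theta) * us x)%C /\
     near_field k theta usl (translate1 l x)
       = (expi (k * l * sin theta) * near_field k theta us x)%C) /\
  (forall xhat, upper_circle xhat ->
     uinfl xhat = (expi (k * l * (sin theta - fst xhat)) * uinf xhat)%C).
Proof.
  intros Hh Hsupp _ _ [Hus _] [_ Hunique] Hff Hffl.
  assert (Htr : forall x, domain_above (surface h) x ->
     usl (translate1 l x) = (expi (k * l * sin theta) * us x)%C).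
  { intros x Hx.
    rewrite <- (Hunique (translated_field k l theta us)).
    - unfold translated_field. rewrite translate1_opp. reflexivity.
    - apply (scattering_solution_translated h k l theta us uinf); assumption.
    - left. apply domain_above_shifted. rewrite translate1_opp. exact Hx. }
  split.
  - intros x Hx. split; [apply Htr, Hx|].
    unfold near_field. rewrite reflected_wave_translate1, (Htr x Hx). ring.
  - intros e He. destruct (surface_flat_at_infinity h Hh Hsupp) as [R0 Hflat].
    destruct Hus as [_ [Hcont _]].
    apply (far_field_translated h R0 l k theta us usl uinf uinfl e); assumption.
Qed.
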